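(* Let $d\ge 1$, let $\mathbf{k}=(k_1,\dots,k_d)\in\mathbb{N}_0^d$, and let $n\ge|\mathbf{k}|$ be an integer. Let $a,b,c,\beta,\mu,\gamma$ be real parameters with $a>0$, $b+|\mathbf{k}|>0$, $c>0$, $\mu>-\tfrac12$ and $2|\mathbf{k}|+2\mu+\beta+d>0$. For $(t,\boldsymbol{x})=(t,x_1,\dots,x_d)\in\mathbb{R}^{d+1}$ put $$g_{n,\mathbf{k}}(t,\boldsymbol{x};a,b,c,\beta,\mu,\gamma)=\prod_{j=1}^{d}(1-\tanh^2x_j)^{a+\frac{d-j}{4}}\,(1+\tanh t)^b(1-\tanh t)^c\;\mathsf{J}^{\beta,\mu,\gamma}_{\mathbf{k},n}(\tau_1,\dots,\tau_{d+1}),$$ where $\tau_1=\frac{1+\tanh t}{2}$, $\tau_{j+1}=\frac{1+\tanh t}{2}\tanh x_j\prod_{i=1}^{j-1}\sqrt{1-\tanh^2x_i}$ for $1\le j\le d$, and $\mathsf{J}^{\beta,\mu,\gamma}_{\mathbf{k},n}$ is the Jacobi polynomial on the cone defined in the context. Then for all real $\xi_1,\dots,\xi_{d+1}$ the Fourier transform $$\mathcal{F}(g_{n,\mathbf{k}})(\xi_1,\dots,\xi_{d+1})=\int_{\mathbb{R}^{d+1}}e^{-i(\xi_1x_1+\cdots+\xi_dx_d+\xi_{d+1}t)}g_{n,\mathbf{k}}(t,\boldsymbol{x};a,b,c,\beta,\mu,\gamma)\,d\boldsymbol{x}\,dt$$ is given by $$\mathcal{F}(g_{n,\mathbf{k}})=2^{\,b+c-1+2ad+\frac{d(d-5)}{4}+\sum_{j=1}^{d-1}jk_{j+1}}\;\frac{(2|\mathbf{k}|+2\mu+\beta+d)_{n-|\mathbf{k}|}\,\Gamma\!\left(b+|\mathbf{k}|-\frac{i\xi_{d+1}}{2}\right)\Gamma\!\left(c+\frac{i\xi_{d+1}}{2}\right)}{(n-|\mathbf{k}|)!\;\Gamma(|\mathbf{k}|+b+c)}$$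 $$\times\prod_{j=1}^{d}\left\{\frac{\left(2\left(|\mathbf{k}^{j+1}|+\mu+\frac{d-j}{2}\right)\right)_{k_j}}{k_j!}\,\Theta_j^d(a,\mu,\mathbf{k};\xi_j)\right\}\Xi(n,\mathbf{k},b,c,\mu,\beta,\gamma,\xi_{d+1}),$$ where $$\Xi(n,\mathbf{k},b,c,\mu,\beta,\gamma,\xi_{d+1})={}_3F_2\!\left(\begin{matrix}-n+|\mathbf{k}|,\ n+|\mathbf{k}|+2\mu+\beta+\gamma+d,\ |\mathbf{k}|+b-\frac{i\xi_{d+1}}{2}\\ 2|\mathbf{k}|+2\mu+\beta+d,\ |\mathbf{k}|+b+c\end{matrix}\,\Big|\,1\right)$$ and $$\Theta_j^d(a,\mu,\mathbf{k};\xi_j)=B\!\left(a+\tfrac{|\mathbf{k}^{j+1}|+i\xi_j}{2}+\tfrac{d-j}{4},\;a+\tfrac{|\mathbf{k}^{j+1}|-i\xi_j}{2}+\tfrac{d-j}{4}\right)$$ $$\times{}_3F_2\!\left(\begin{matrix}-k_j,\ k_j+2\left(|\mathbf{k}^{j+1}|+\mu+\frac{d-j}{2}\right),\ a+\frac{|\mathbf{k}^{j+1}|+i\xi_j}{2}+\frac{d-j}{4}\\ |\mathbf{k}^{j+1}|+\mu+\frac{d-j+1}{2},\ |\mathbf{k}^{j+1}|+2a+\frac{d-j}{2}\end{matrix}\,\Big|\,1\right).$$ Equivalently, in terms of the continuous Hahn polynomials $p_k$, $$\Theta_j^d(a,\mu,\mathbf{k};\xi_j)=\frac{k_j!}{i^{k_j}\left(|\mathbf{k}^{j+1}|+\mu+\frac{d-j+1}{2}\right)_{k_j}\left(|\mathbf{k}^{j+1}|+2a+\frac{d-j}{2}\right)_{k_j}}$$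 $$\times B\!\left(a+\tfrac{|\mathbf{k}^{j+1}|+i\xi_j}{2}+\tfrac{d-j}{4},\;a+\tfrac{|\mathbf{k}^{j+1}|-i\xi_j}{2}+\tfrac{d-j}{4}\right)p_{k_j}\!\left(\tfrac{\xi_j}{2};\,A_j,\,M_j,\,M_j,\,A_j\right),$$ where $A_j=a+\frac{|\mathbf{k}^{j+1}|}{2}+\frac{d-j}{4}$ and $M_j=\mu-a+\frac{|\mathbf{k}^{j+1}|+1}{2}+\frac{d-j}{4}$.
   Context: Notation: $\mathbb{N}_0=\{0,1,2,\dots\}$; $|\mathbf{k}|=k_1+\cdots+k_d$; $|\mathbf{k}^{j}|=k_j+\cdots+k_d$ for $1\le j\le d$, and $|\mathbf{k}^{d+1}|=0$. The symbol $i$ is the imaginary unit (when not used as an index). Pochhammer symbol: $(\alpha)_0=1$, $(\alpha)_n=\alpha(\alpha+1)\cdots(\alpha+n-1)$ for $n\ge1$. Hypergeometric function: ${}_pF_q\!\left(\begin{matrix}a_1,\dots,a_p\\ b_1,\dots,b_q\end{matrix}\Big|x\right)=\sum_{n\ge0}\frac{(a_1)_n\cdots(a_p)_n}{(b_1)_n\cdots(b_q)_n}\frac{x^n}{n!}$ (all series used here terminate, having a nonpositive integer upper parameter). $B(x,y)=\Gamma(x)\Gamma(y)/\Gamma(x+y)$ is the beta function. Gegenbauer polynomials: $C_n^{(\lambda)}(x)=\frac{(2\lambda)_n}{n!}\,{}_2F_1\!\left(\begin{matrix}-n,\ n+2\lambda\\ \lambda+\frac12\end{matrix}\Big|\frac{1-x}{2}\right)$.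 Jacobi polynomials: $P_n^{(\alpha,\gamma)}(s)=\frac{(\alpha+1)_n}{n!}\,{}_2F_1\!\left(\begin{matrix}-n,\ n+\alpha+\gamma+1\\ \alpha+1\end{matrix}\Big|\frac{1-s}{2}\right)$. Ball polynomials: for $\boldsymbol{x}=(x_1,\dots,x_d)$, with $\boldsymbol{x}_0=0$, $\boldsymbol{x}_j=(x_1,\dots,x_j)$ and $\|\cdot\|$ the Euclidean norm, $$P_{\mathbf{k}}^{\mu}(\boldsymbol{x})=\prod_{j=1}^d(1-\|\boldsymbol{x}_{j-1}\|^2)^{k_j/2}\,C_{k_j}^{(\lambda_j)}\!\left(\frac{x_j}{\sqrt{1-\|\boldsymbol{x}_{j-1}\|^2}}\right),\qquad \lambda_j=\mu+|\mathbf{k}^{j+1}|+\frac{d-j}{2}.$$ Jacobi polynomials on the cone: for $|\mathbf{k}|\le n$, $$\mathsf{J}^{\beta,\mu,\gamma}_{\mathbf{k},n}(t,\boldsymbol{x})=P_{n-|\mathbf{k}|}^{(2|\mathbf{k}|+2\mu+\beta+d-1,\,\gamma)}(1-2t)\;t^{|\mathbf{k}|}\,P_{\mathbf{k}}^{\mu}\!\left(\frac{\boldsymbol{x}}{t}\right).$$ Continuous Hahn polynomials: $$p_k(x;a,b,c,d)=i^k\frac{(a+c)_k(a+d)_k}{k!}\,{}_3F_2\!\left(\begin{matrix}-k,\ k+a+b+c+d-1,\ a+ix\\ a+c,\ a+d\end{matrix}\Big|1\right).$$ *)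

(* Defs.v *)
From HB Require Import structures.
From mathcomp Require Import all_boot all_order all_algebra.
From mathcomp Require Import all_classical all_reals all_analysis.
From mathcomp.real_closed Require Import complex.

Set Implicit Arguments.
Unset Strict Implicit.
Unset Printing Implicit Defensive.

Import Order.TTheory GRing.Theory Num.Theory.
Import numFieldNormedType.Exports.

Local Open Scope classical_set_scope.
Local Open Scope ring_scope.

Section hypergeometric.
Context {K : numFieldType}.
Implicit Types (a x : K) (us ls : seq K) (n : nat).

Definition pochhammer a n : K := \prod_(i < n) (a + i%:R).

Definition hypergeometric us ls x : K :=
  limn (series (fun n => (\prod_(u <- us) pochhammer u n) /
                         (\prod_(l <- ls) pochhammer l n) *
                         (x ^+ n / n`!%:R))).

Definition gegenbauer (lambda : K) n x : K :=
  pochhammer (2 * lambda) n / n`!%:R *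
  hypergeometric [:: - n%:R; n%:R + 2 * lambda] [:: lambda + 2^-1]
    ((1 - x) / 2).

Definition jacobi (alpha gamma : K) n x : K :=
  pochhammer (alpha + 1) n / n`!%:R *
  hypergeometric [:: - n%:R; n%:R + alpha + gamma + 1] [:: alpha + 1]
    ((1 - x) / 2).

End hypergeometric.

Section tuple_measure.
Context d (T : measurableType d) (R : realType).
Local Open Scope ereal_scope.

Definition cons_pair n (p : T * n.-tuple T) : n.+1.-tuple T :=
  [tuple of p.1 :: p.2].

Lemma measurable_cons_pair n : measurable_fun setT (@cons_pair n).
Proof. exact: measurable_cons. Qed.

Section cons.
Context n (m1 : {sigma_finite_measure set T -> \bar R})
  (m2 : {sigma_finite_measure set (n.-tuple T) -> \bar R}).

Definition cons_measure : set (n.+1.-tuple T) -> \bar R :=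
  pushforward (m1 \x m2) (@cons_pair n).

Let push : {measure set (n.+1.-tuple T) -> \bar R} :=
  measure_function_pushforward__canonical__measure_function_Measure
    (m1 \x m2) (@measurable_cons_pair n).

HB.instance Definition _ := isMeasure.Build _ _ _ cons_measure
  (measure0 push) (measure_ge0 push) (@measure_semi_sigma_additive _ _ _ push).

Let cons_measure_sigma_finite : sigma_finite setT cons_measure.
Proof.
have /sigma_finiteP[F [FT ndF Foo]] := sigma_finiteT m1.
have /sigma_finiteP[G [GT ndG Goo]] := sigma_finiteT m2.
pose uncons (z : n.+1.-tuple T) : T * n.-tuple T :=
  (tnth z ord0, [tuple of behead z]).
have unconsK p : uncons (cons_pair p) = p.
  by case: p => x y; rewrite /uncons/=; congr pair; apply: val_inj.
have munc : measurable_fun setT uncons.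
  apply/measurable_fun_pair; [exact: measurable_tnth|exact: measurable_behead].
exists (fun i => uncons @^-1` (F i `*` G i)).
  apply/esym; rewrite -subTset => z _.
  have [i _ Fi] : (\bigcup_i F i) (uncons z).1 by rewrite -FT.
  have [j _ Gj] : (\bigcup_i G i) (uncons z).2 by rewrite -GT.
  exists (maxn i j) => //; split.
    by move: Fi; exact/subsetPset/ndF/leq_maxl.
  by move: Gj; exact/subsetPset/ndG/leq_maxr.
move=> i; have [mF Fi] := Foo i; have [mG Gi] := Goo i; split.
  by rewrite -[X in measurable X]setTI; apply: munc => //; exact: measurableX.
rewrite /cons_measure /pushforward -comp_preimage.
rewrite (_ : uncons \o _ = id); last by apply/funext => p /=; rewrite unconsK.
by rewrite preimage_id product_measure1E// lte_mul_pinfty// ge0_fin_numE.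
Qed.

HB.instance Definition _ := Measure_isSigmaFinite.Build _ _ _ cons_measure
  cons_measure_sigma_finite.
End cons.

Fixpoint tuple_measure (m : {sigma_finite_measure set T -> \bar R}) n :
    {sigma_finite_measure set (n.-tuple T) -> \bar R} :=
  if n is n'.+1 then cons_measure m (tuple_measure m n') else \d_[tuple].

End tuple_measure.

Section complex_analysis.
Context {R : realType}.
Local Open Scope complex_scope.

(* [measurableTypeR R] is [R] with the Borel sigma-algebra; the tuples over the
   bare type [R] would carry another one. *)
Definition Rn n := n.-tuple (measurableTypeR R).

Definition lebesgue_Rn n : {sigma_finite_measure set (Rn n) -> \bar R} :=
  tuple_measure (@lebesgue_measure R) n.

Definition cexp (z : R[i]) : R[i] :=
  (expR (complex.Re z))%:C *
  (cos (complex.Im z) +i* sin (complex.Im z)).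

Definition cintegral d (T : measurableType d) (m : {measure set T -> \bar R})
    (D : set T) (f : T -> R[i]) : R[i] :=
  (\int[m]_(x in D) complex.Re (f x)) +i* (\int[m]_(x in D) complex.Im (f x)).

(* Euler's integral, with t^(z - 1) = exp ((z - 1) ln t); it represents the
   Gamma function on the half-plane Re z > 0 only. *)
Definition cgamma (z : R[i]) : R[i] :=
  cintegral (@lebesgue_measure R) `]0, +oo[
    (fun t => cexp ((z - 1) * (ln t)%:C) * (expR (- t))%:C).

Definition cbeta (z w : R[i]) : R[i] := cgamma z * cgamma w / cgamma (z + w).

Definition fourier n (f : Rn n -> R[i]) (xi : 'I_n -> R) : R[i] :=
  cintegral (lebesgue_Rn n) setT
    (fun x => cexp (- ('i * (\sum_(j < n) xi j * tnth x j)%:C)) * f x).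

Definition continuous_hahn n (x a b c e : R[i]) : R[i] :=
  'i ^+ n * (pochhammer (a + c) n * pochhammer (a + e) n / n`!%:R) *
  hypergeometric [:: - n%:R; n%:R + a + b + c + e - 1; a + 'i * x]
    [:: a + c; a + e] 1.

Definition tanh (x : R) : R :=
  (expR x - expR (- x)) / (expR x + expR (- x)).

End complex_analysis.

(* Indices j : 'I_d start at 0, so j stands for the classical index j + 1:
   [tail_degree k j] is the sum of the entries of k strictly after the one at
   j, and the classical d - j is [codim j]. *)
Section cone.
Context {R : realType} {d : nat}.
Implicit Types (k : 'I_d -> nat) (x : 'I_d -> R) (j : 'I_d).

Definition degree k : nat := \sum_(l < d) k l.

Definition tail_degree k j : nat := \sum_(l < d | (j < l)%N) k l.

Definition codim j : nat := (d - j.+1)%N.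

Definition lambda (mu : R) k j : R :=
  mu + (tail_degree k j)%:R + (codim j)%:R / 2.

Definition sqnorm_before x j : R := \sum_(l < d | (l < j)%N) x l ^+ 2.

Definition ball_poly (mu : R) k x : R :=
  \prod_(j < d)
    ((1 - sqnorm_before x j) `^ ((k j)%:R / 2) *
     gegenbauer (lambda mu k j) (k j)
       (x j / Num.sqrt (1 - sqnorm_before x j))).

Definition cone_jacobi (beta mu gamma : R) k n (t : R) x : R :=
  jacobi (2 * (degree k)%:R + 2 * mu + beta + d%:R - 1) gamma
    (n - degree k)%N (1 - 2 * t) *
  t ^+ degree k * ball_poly mu k (fun j => x j / t).

Definition tau_cone (t : R) : R := (1 + tanh t) / 2.

Definition tau_ball (t : R) x j : R :=
  (1 + tanh t) / 2 * tanh (x j) *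
  \prod_(l < d | (l < j)%N) Num.sqrt (1 - tanh (x l) ^+ 2).

(* A point of R^(d+1) is (x_1, ..., x_d, t), t last, to match the order of the
   frequencies xi_1, ..., xi_(d+1). *)
Definition cone_fun n k (a b c beta mu gamma : R) (z : Rn d.+1) : R :=
  let x j : R := tnth z (widen_ord (leqnSn d) j) in
  let t : R := tnth z ord_max in
  (\prod_(j < d) (1 - tanh (x j) ^+ 2) `^ (a + (codim j)%:R / 4)) *
  (1 + tanh t) `^ b * (1 - tanh t) `^ c *
  cone_jacobi beta mu gamma k n (tau_cone t) (tau_ball t x).

Local Open Scope complex_scope.

Definition Xi n k (b c mu beta gamma xi : R) : R[i] :=
  hypergeometric
    [:: - n%:R + (degree k)%:R;
        (n%:R + (degree k)%:R + 2 * mu + beta + gamma + d%:R)%:C;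
        ((degree k)%:R + b)%:C - 'i * xi%:C / 2]
    [:: (2 * (degree k)%:R + 2 * mu + beta + d%:R)%:C;
        ((degree k)%:R + b + c)%:C]
    1.

Definition theta_beta (a : R) k (xi : R) j : R[i] :=
  cbeta
    (a%:C + ((tail_degree k j)%:R + 'i * xi%:C) / 2 + (codim j)%:R / 4)
    (a%:C + ((tail_degree k j)%:R - 'i * xi%:C) / 2 + (codim j)%:R / 4).

Definition Theta (a mu : R) k (xi : R) j : R[i] :=
  theta_beta a k xi j *
  hypergeometric
    [:: - (k j)%:R;
        (k j)%:R + 2 * ((tail_degree k j)%:R + mu%:C + (codim j)%:R / 2);
        a%:C + ((tail_degree k j)%:R + 'i * xi%:C) / 2 + (codim j)%:R / 4]
    [:: (tail_degree k j)%:R + mu%:C + ((codim j)%:R + 1) / 2;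
        (tail_degree k j)%:R + 2 * a%:C + (codim j)%:R / 2]
    1.

Definition hahn_A (a : R) k j : R :=
  a + (tail_degree k j)%:R / 2 + (codim j)%:R / 4.

Definition hahn_M (a mu : R) k j : R :=
  mu - a + ((tail_degree k j)%:R + 1) / 2 + (codim j)%:R / 4.

End cone.

(* Main.v *)
Require Import Defs.
From mathcomp Require Import all_boot all_order all_algebra.
From mathcomp Require Import all_classical all_reals all_analysis.
From mathcomp.real_closed Require Import complex.
From mathcomp Require Import measurable_realfun.
From mathcomp Require Import ring lra.

Import Order.TTheory GRing.Theory Num.Theory.
Import numFieldNormedType.Exports.

Set Implicit Arguments.
Unset Strict Implicit.
Unset Printing Implicit Defensive.

Local Open Scope classical_set_scope.
Local Open Scope ring_scope.
Local Open Scope complex_scope.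

(** Why the formula holds.  With s_j = tanh x_j the point tau of the cone is
    given by spherical-type coordinates: tau_1 = (1 + tanh t) / 2, and the
    rescaled vector y = (tau_2, ..., tau_(d+1)) / tau_1 satisfies
    1 - |y_(<j)|^2 = prod_(l<j) (1 - s_l^2).  The arguments of the Gegenbauer
    polynomials thus become the s_j themselves, the radial powers redistribute
    over the coordinates, and the function to be transformed is a product of
    functions of one variable ([cone_fun_prod]); so is the exponential.  By
    Fubini's theorem the transform is a product of d + 1 integrals over the
    line ([cintegral_tuple]).

    Each of these integrals has the shape
      int e^(-i xi t) (1 + tanh t)^p (1 - tanh t)^q Q((1 +- tanh t) / 2) dt
    for a terminating 2F1 polynomial Q.  Without Q it is a beta integral
    ([tanh_integral]), equal to
      2^(p+q-1) Gamma(p - i xi/2) Gamma(q + i xi/2) / Gamma(p + q).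
    A power of (1 +- tanh t) / 2 shifts p or q by an integer, which by the
    recursion Gamma(z + 1) = z Gamma(z) multiplies the value by a ratio of
    Pochhammer symbols; summing over the monomials of Q turns the 2F1 into a
    3F2 at 1 ([cintegral_hypergeometric]).

    The two facts about the complex Gamma function come from the substitution
    t = exp u in Euler's integral ([cgammaE]),
      Gamma(p + i q) = int e^(p u - e^u) e^(i q u) du,
    with an integrand that is dominated by a multiple of 1 / (1 + u^2).  The
    recursion expresses that the derivative of this integrand integrates to
    zero ([gamma_kernel_by_parts]).  For the beta integral
    ([beta_integral]) the product of two such integrals, in u and v, is
    rewritten with u = 2 t + v: the phases collapse to e^(-i xi t), and
    e^(2t+v) + e^v = e^(v + L(t)) with L(t) = log (1 + e^(2t)), so that the
    integral over v is Gamma(p + q) times a function of t which is, up to a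
    power of 2, the weight (1 + tanh t)^p (1 - tanh t)^q.

    The form with continuous Hahn polynomials is a rewriting of the 3F2, in
    which the Pochhammer symbols to be cancelled are nonzero because their
    arguments are positive reals. *)

(** * Complex-valued integrals and Fubini's theorem *)

Section cintegral.
Context d (T : measurableType d) (R : realType).
Variable mu : {measure set T -> \bar R}.
Implicit Types (f g : T -> R[i]) (h : T -> R).

Definition cintegrable f : Prop :=
  mu.-integrable setT (EFin \o (fun x => complex.Re (f x))) /\
  mu.-integrable setT (EFin \o (fun x => complex.Im (f x))).

Lemma cintegrableD f g : cintegrable f -> cintegrable g ->
  cintegrable (fun x => f x + g x).
Proof.
move=> [fr fi] [gr gi]; split.
  apply: (eq_integrable _ _ _ _ (integrableD measurableT fr gr)) => // x _ /=.
  by case: (f x) (g x) => ? ? [].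
apply: (eq_integrable _ _ _ _ (integrableD measurableT fi gi)) => // x _ /=.
by case: (f x) (g x) => ? ? [].
Qed.

Lemma cintegralD f g : cintegrable f -> cintegrable g ->
  cintegral mu setT (fun x => f x + g x) =
  cintegral mu setT f + cintegral mu setT g.
Proof.
move=> [fr fi] [gr gi]; rewrite /cintegral.
have reE x : complex.Re (f x + g x) = complex.Re (f x) + complex.Re (g x).
  by case: (f x) (g x) => ? ? [].
have imE x : complex.Im (f x + g x) = complex.Im (f x) + complex.Im (g x).
  by case: (f x) (g x) => ? ? [].
under [X in X +i* _]eq_Rintegral do rewrite reE.
under [X in _ +i* X]eq_Rintegral do rewrite imE.
by rewrite /= !RintegralD.
Qed.

Lemma cintegrableZ (a : R[i]) f : cintegrable f ->
  cintegrable (fun x => a * f x).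
Proof.
case: a => ar ai [fr fi]; split.
  have := integrableB measurableT (integrableZl measurableT ar fr)
                                  (integrableZl measurableT ai fi).
  apply: eq_integrable => // x _ /=; case: (f x) => u v /=.
  by rewrite -!EFinM -EFinB.
have := integrableD measurableT (integrableZl measurableT ar fi)
                                (integrableZl measurableT ai fr).
apply: eq_integrable => // x _ /=; case: (f x) => u v /=.
by rewrite -!EFinM -EFinD.
Qed.

Lemma cintegralZ (a : R[i]) f : cintegrable f ->
  cintegral mu setT (fun x => a * f x) = a * cintegral mu setT f.
Proof.
case: a => ar ai [fr fi]; rewrite /cintegral.
have reE x : complex.Re ((ar +i* ai) * f x) =
    ar * complex.Re (f x) - ai * complex.Im (f x) by case: (f x).
have imE x : complex.Im ((ar +i* ai) * f x) =
    ar * complex.Im (f x) + ai * complex.Re (f x) by case: (f x).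
under [X in X +i* _]eq_Rintegral do rewrite reE.
under [X in _ +i* X]eq_Rintegral do rewrite imE.
have Z (r : R) h : mu.-integrable setT (EFin \o h) ->
    mu.-integrable setT (EFin \o (fun x => r * h x)).
  by move=> /(integrableZl measurableT r); apply: eq_integrable.
rewrite RintegralB ?RintegralD//; try exact: Z.
by rewrite !RintegralZl//.
Qed.

Lemma cintegrable_sum n (f : nat -> T -> R[i]) :
  (forall i, cintegrable (f i)) -> cintegrable (fun x => \sum_(i < n) f i x).
Proof.
move=> fi; elim: n => [|n ih].
  under eq_fun do rewrite big_ord0.
  by split; exact: integrable0.
under eq_fun do rewrite big_ord_recr.
exact: cintegrableD.
Qed.

Lemma cintegral_sum n (f : nat -> T -> R[i]) :
  (forall i, cintegrable (f i)) ->
  cintegral mu setT (fun x => \sum_(i < n) f i x) =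
  \sum_(i < n) cintegral mu setT (f i).
Proof.
move=> fi; elim: n => [|n ih].
  under eq_fun do rewrite big_ord0.
  rewrite big_ord0 /cintegral /= /Rintegral.
  by rewrite integral0.
under eq_fun do rewrite big_ord_recr.
by rewrite cintegralD ?ih ?big_ord_recr//; exact: cintegrable_sum.
Qed.

Lemma cintegrableC h : mu.-integrable setT (EFin \o h) ->
  cintegrable (fun x => (h x)%:C).
Proof. by move=> hi; split => //; exact: integrable0. Qed.

Lemma cintegralC h :
  cintegral mu setT (fun x => (h x)%:C) = (\int[mu]_x h x)%:C.
Proof. by rewrite /cintegral /= /Rintegral integral0. Qed.

End cintegral.

Section product.
Context d1 d2 (T1 : measurableType d1) (T2 : measurableType d2) (R : realType).
Variables (m1 : {sigma_finite_measure set T1 -> \bar R}).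
Variables (m2 : {sigma_finite_measure set T2 -> \bar R}).

Lemma integrable_prod (f : T1 -> R) (g : T2 -> R) :
  m1.-integrable setT (EFin \o f) -> m2.-integrable setT (EFin \o g) ->
  (m1 \x m2)%E.-integrable setT (EFin \o (fun z => f z.1 * g z.2)).
Proof.
move=> fi gi.
have mf : measurable_fun setT f by exact/measurable_EFinP/(measurable_int _ fi).
have mg : measurable_fun setT g by exact/measurable_EFinP/(measurable_int _ gi).
apply/integrable12ltyP.
  apply/measurable_EFinP; apply: measurable_funM.
    exact: measurableT_comp.
  exact: measurableT_comp.
rewrite /=; under eq_integral => x _.
  under eq_integral do rewrite normrM EFinM.
  rewrite ge0_integralZl_EFin//; last first.
    by apply/measurable_EFinP; exact: measurableT_comp.
  over.
have gfin : (\int[m2]_y `|g y|%:E)%E \is a fin_num.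
  by apply: (@integrable_fin_num _ _ _ m2) => //; exact: integrable_norm.
rewrite -(fineK gfin) ge0_integralZr//; last 2 first.
- by apply/measurable_EFinP; exact: measurableT_comp.
- by rewrite lee_fin fine_ge0// integral_ge0.
have ffin : (\int[m1]_x `|f x|%:E)%E \is a fin_num.
  by apply: (@integrable_fin_num _ _ _ m1) => //; exact: integrable_norm.
by rewrite -(fineK ffin) -EFinM ltry.
Qed.

Lemma Rintegral_prod (f : T1 -> R) (g : T2 -> R) :
  m1.-integrable setT (EFin \o f) -> m2.-integrable setT (EFin \o g) ->
  \int[(m1 \x m2)%E]_z (f z.1 * g z.2) = \int[m1]_x f x * \int[m2]_y g y.
Proof.
move=> fi gi; rewrite /Rintegral.
have /= <- := integral12_prod_meas1 (integrable_prod fi gi).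
under eq_integral => x _.
  rewrite /fubini_F /=.
  under eq_integral do rewrite EFinM.
  rewrite integralZl//.
  over.
have gfin := integrable_fin_num measurableT gi.
have ffin := integrable_fin_num measurableT fi.
by rewrite -(fineK gfin) integralZr//= -(fineK ffin).
Qed.

Lemma cintegrable_prod (f : T1 -> R[i]) (g : T2 -> R[i]) :
  cintegrable m1 f -> cintegrable m2 g ->
  cintegrable (m1 \x m2)%E (fun z => f z.1 * g z.2).
Proof.
move=> [fr fi] [gr gi]; split.
  have := integrableB measurableT (integrable_prod fr gr) (integrable_prod fi gi).
  by apply: eq_integrable => // x _ /=; case: (f x.1) (g x.2) => ? ? [].
have := integrableD measurableT (integrable_prod fr gi) (integrable_prod fi gr).
by apply: eq_integrable => // x _ /=; case: (f x.1) (g x.2) => ? ? [].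
Qed.

Lemma cintegral_prod (f : T1 -> R[i]) (g : T2 -> R[i]) :
  cintegrable m1 f -> cintegrable m2 g ->
  cintegral (m1 \x m2)%E setT (fun z => f z.1 * g z.2) =
  cintegral m1 setT f * cintegral m2 setT g.
Proof.
move=> [fr fi] [gr gi]; rewrite /cintegral.
have reE z : complex.Re (f z.1 * g z.2) =
    complex.Re (f z.1) * complex.Re (g z.2) -
    complex.Im (f z.1) * complex.Im (g z.2).
  by case: (f z.1) (g z.2) => ? ? [].
have imE z : complex.Im (f z.1 * g z.2) =
    complex.Re (f z.1) * complex.Im (g z.2) +
    complex.Im (f z.1) * complex.Re (g z.2).
  by case: (f z.1) (g z.2) => ? ? [].
under [X in X +i* _]eq_Rintegral do rewrite reE.
under [X in _ +i* X]eq_Rintegral do rewrite imE.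
rewrite RintegralB ?RintegralD//;
  [|exact: integrable_prod fr gi|exact: integrable_prod fi gr
   |exact: integrable_prod fr gr|exact: integrable_prod fi gi].
by rewrite (Rintegral_prod fr gr) (Rintegral_prod fi gi) (Rintegral_prod fr gi)
           (Rintegral_prod fi gr).
Qed.

(** The real-valued integral sends an infinite inner integral to 0; asking for
    every section to be integrable keeps the iterated integrals genuine without
    an almost everywhere argument. *)
Lemma Rintegral_fubini (f : T1 * T2 -> R) :
  (m1 \x m2)%E.-integrable setT (EFin \o f) ->
  (forall x, m2.-integrable setT (EFin \o (fun y => f (x, y)))) ->
  (forall y, m1.-integrable setT (EFin \o (fun x => f (x, y)))) ->
  \int[m1]_x \int[m2]_y f (x, y) = \int[m2]_y \int[m1]_x f (x, y).
Proof.
move=> fi f1 f2; rewrite /Rintegral.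
congr fine.
under eq_integral do rewrite fineK ?(integrable_fin_num measurableT (f1 _))//.
under [RHS]eq_integral do
  rewrite fineK ?(integrable_fin_num measurableT (f2 _))//.
exact: (Fubini fi).
Qed.

Lemma cintegral_fubini (f : T1 * T2 -> R[i]) :
  cintegrable (m1 \x m2)%E f ->
  (forall x, cintegrable m2 (fun y => f (x, y))) ->
  (forall y, cintegrable m1 (fun x => f (x, y))) ->
  cintegral m1 setT (fun x => cintegral m2 setT (fun y => f (x, y))) =
  cintegral m2 setT (fun y => cintegral m1 setT (fun x => f (x, y))).
Proof.
move=> [fr fi] f1 f2; rewrite /cintegral /=.
congr (_ +i* _).
  apply: (Rintegral_fubini (f := fun z => complex.Re (f z))) => //.
  - by move=> x; case: (f1 x).
  - by move=> y; case: (f2 y).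
apply: (Rintegral_fubini (f := fun z => complex.Im (f z))) => //.
- by move=> x; case: (f1 x).
- by move=> y; case: (f2 y).
Qed.

End product.

(** * Products of functions of one variable *)

Section tuple.
Context d (T : measurableType d) (R : realType).

(** The measure on tuples is an image measure under [cons_pair]; its inverse
    brings functions on tuples back to the product space. *)
Definition uncons_pair n (z : n.+1.-tuple T) : T * n.-tuple T :=
  (tnth z ord0, [tuple of behead z]).

Lemma cons_pairK n : cancel (@cons_pair d T n) (@uncons_pair n).
Proof.
by case=> x y; rewrite /uncons_pair; congr pair; apply: val_inj.
Qed.

Lemma measurable_uncons_pair n :
  measurable_fun (U := [the measurableType _ of (T * n.-tuple T)%type])
    setT (@uncons_pair n).
Proof.
by apply/measurable_fun_pair;
  [exact: measurable_tnth|exact: measurable_behead].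
Qed.

Section cons.
Variables (n : nat) (m1 : {sigma_finite_measure set T -> \bar R}).
Variable (m2 : {sigma_finite_measure set (n.-tuple T) -> \bar R}).

Lemma integrable_cons (h : T * n.-tuple T -> R) :
  (m1 \x m2)%E.-integrable setT (EFin \o h) ->
  (cons_measure m1 m2).-integrable setT (EFin \o (h \o @uncons_pair n)).
Proof.
move=> hi.
have /measurable_EFinP mh := measurable_int _ hi.
have := @integrable_pushforward _ _ _ _ R _ (@measurable_cons_pair d T n)
  (m1 \x m2)%E setT (EFin \o (h \o @uncons_pair n)).
apply=> //.
- apply/measurable_EFinP; exact: (measurableT_comp mh (@measurable_uncons_pair n)).
- rewrite preimage_setT; apply: eq_integrable hi => // z _ /=.
  by rewrite cons_pairK.
Qed.

Lemma Rintegral_cons (h : T * n.-tuple T -> R) :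
  (m1 \x m2)%E.-integrable setT (EFin \o h) ->
  \int[cons_measure m1 m2]_z h (uncons_pair z) = \int[(m1 \x m2)%E]_z h z.
Proof.
move=> hi; rewrite /Rintegral; congr fine.
have /measurable_EFinP mh := measurable_int _ hi.
have := @integral_pushforward _ _ _ _ R _ (@measurable_cons_pair d T n)
  (m1 \x m2)%E setT (EFin \o (h \o @uncons_pair n)).
rewrite /cons_measure => ->//.
- rewrite preimage_setT; apply: eq_integral => z _ /=.
  by rewrite cons_pairK.
- apply/measurable_EFinP; exact: (measurableT_comp mh (@measurable_uncons_pair n)).
- rewrite preimage_setT; apply: eq_integrable hi => // z _ /=.
  by rewrite cons_pairK.
Qed.

End cons.

Variable m : {sigma_finite_measure set T -> \bar R}.

(** Fubini for separated variables, by induction on the number of variables. *)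
Lemma cintegral_tuple n (f : 'I_n -> T -> R[i]) :
  (forall i, cintegrable m (f i)) ->
  cintegrable (tuple_measure m n) (fun z => \prod_(i < n) f i (tnth z i)) /\
  cintegral (tuple_measure m n) setT (fun z => \prod_(i < n) f i (tnth z i)) =
  \prod_(i < n) cintegral m setT (f i).
Proof.
elim: n f => [|n ih] f fi.
  under [X in cintegrable _ X]eq_fun do rewrite big_ord0.
  under [X in cintegral _ _ X]eq_fun do rewrite big_ord0.
  rewrite big_ord0 /=; split.
    split; last exact: integrable0.
    by apply: finite_measure_integrable_cst.
  rewrite /cintegral /= /Rintegral !integral_dirac//=.
  by rewrite indicT mulr1 mulr0.
have [gi gE] := ih (fun i => f (lift ord0 i)) (fun i => fi _).
pose h p := f ord0 p.1 * \prod_(i < n) f (lift ord0 i) (tnth p.2 i).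
have hE : (fun z => \prod_(i < n.+1) f i (tnth z i)) = h \o @uncons_pair n.
  apply/funext => z; rewrite big_ord_recl /h /=; congr (_ * _).
  apply: eq_bigr => i _; congr (f _ _).
  by rewrite [in LHS](tuple_eta z) tnthS.
have hi : cintegrable (m \x tuple_measure m n)%E h.
  exact: (cintegrable_prod (fi ord0) gi).
rewrite hE /=; split.
  by case: hi => hr hi; split; [exact: integrable_cons hr
                               |exact: integrable_cons hi].
rewrite big_ord_recl -gE -(cintegral_prod (fi ord0) gi) -/h.
case: hi => hr hi; rewrite /cintegral /=.
by rewrite (Rintegral_cons hr) (Rintegral_cons hi).
Qed.

End tuple.

(** * Integration over the line *)

Section line.
Context {R : realType}.
Notation mu := (@lebesgue_measure R).
Implicit Types (F G f w : R -> R).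

Definition symitv n : set R := `[- n%:R, n%:R].

Lemma bigcup_symitv : \bigcup_n symitv n = [set: R].
Proof.
rewrite -subTset => x _; exists (Num.truncn `|x|).+1 => //=.
by rewrite /symitv /= in_itv/= -ler_norml ltW// Num.Theory.truncnS_gt.
Qed.

Lemma nondecreasing_symitv :
  {homo symitv : m n / (m <= n)%N >-> (m <= n)%O}.
Proof.
move=> m n mn; apply/subsetPset/subset_itvScc => //.
  by rewrite bnd_simp lerN2 ler_nat.
by rewrite bnd_simp ler_nat.
Qed.

Lemma FTC_symitv F f n : (forall x : R, is_derive x (1 : R) F (f x)) -> continuous f ->
  (\int[mu]_(x in symitv n) (f x)%:E)%E = (F n%:R - F (- n%:R))%:E.
Proof.
move=> dF cf; have [->|n0] := eqVneq n 0%N.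
  by rewrite /symitv oppr0 set_itv1 integral_set1 subrr.
have cF : continuous F.
  move=> x; apply/differentiable_continuous/derivable1_diffP.
  by have [] := dF x.
rewrite (@continuous_FTC2 _ f F) ?EFinB//.
- by rewrite ltrNl -subr_gt0 opprK -natrD ltr0n addn_gt0 lt0n n0.
- exact: continuous_subspaceT.
- split; first by move=> x _; have [] := dF x.
  + by apply: cvg_at_right_filter; exact: cF.
  + by apply: cvg_at_left_filter; exact: cF.
- by move=> x _; rewrite derive1E; have [] := dF x.
Qed.

(** The integrals over [-n, n] stay below 2 M and increase to the integral over
    the line. *)
Lemma integrable_bounded_primitive F f M :
  (forall x : R, is_derive x (1 : R) F (f x)) -> continuous f ->
  (forall x, 0 <= f x) -> (forall x, `|F x| <= M) ->
  mu.-integrable setT (EFin \o f).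
Proof.
move=> dF cf f0 FM.
have mf : measurable_fun setT f by exact: continuous_measurable_fun.
apply/integrableP; split; first exact/measurable_EFinP.
rewrite (@le_lt_trans _ _ (M + M)%:E) ?ltry//.
rewrite -bigcup_symitv.
apply: (@cvge_to_le _ \oo _ _ (fun n => \int[mu]_(x in symitv n) `|(EFin \o f) x|)%E).
  apply: ge0_nondecreasing_set_cvg_integral => //.
  - exact: nondecreasing_symitv.
  - by move=> n; exact: measurable_itv.
  - by move=> n; apply/measurable_funTS/measurableT_comp => //; exact/measurable_EFinP.
apply: nearW => n.
under eq_integral do rewrite /= ger0_norm//.
rewrite (FTC_symitv _ dF cf) lee_fin.
by apply: le_trans (ler_norm _) _; rewrite (le_trans (ler_normB _ _))// lerD.
Qed.

(** The fundamental theorem of calculus on [-n, n], passed to the limit by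
    dominated convergence. *)
Lemma Rintegral_derivative_eq0 F f :
  (forall x : R, is_derive x (1 : R) F (f x)) -> continuous f ->
  mu.-integrable setT (EFin \o f) ->
  F n%:R @[n --> \oo] --> 0 -> F (- n%:R) @[n --> \oo] --> 0 ->
  \int[mu]_x f x = 0.
Proof.
move=> dF cf fi Fy FNy.
have mf : measurable_fun setT f by exact: continuous_measurable_fun.
pose f_ n x : \bar R := (f \_ (symitv n) x)%:E.
have [||||| _ _ h] := @dominated_convergence _ _ R mu setT measurableT f_
  (EFin \o f) (fun x => `|f x|%:E).
- move=> n; apply/measurable_EFinP.
  apply/(measurable_restrictT _ _).1 => //; first exact: measurable_itv.
  exact: measurable_funTS.
- exact/measurable_EFinP.
- apply: aeW => x _; apply: cvg_near_cst.
  exists (Num.truncn `|x|).+1 => // n /= xn.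
  rewrite /f_ patchE mem_set// /symitv /= in_itv/= -ler_norml.
  by rewrite (le_trans (ltW (Num.Theory.truncnS_gt _)))// ler_nat.
- exact: integrable_norm.
- apply: aeW => x n _; rewrite /f_ patchE.
  by case: ifP => _ //=; rewrite normr0 lee_fin.
have {}h : (F n%:R - F (- n%:R))%:E @[n --> \oo] --> (\int[mu]_x (f x)%:E)%E.
  apply: cvg_trans h; apply: near_eq_cvg; apply: nearW => n.
  rewrite -(FTC_symitv _ dF cf) integral_mkcond.
  by apply: eq_integral => x _; rewrite restrict_EFin.
have h0 : (F n%:R - F (- n%:R))%:E @[n --> \oo] --> 0%:E.
  apply: cvg_EFin; first exact: nearW.
  by rewrite -[X in _ --> X]subr0; exact: cvgB.
by rewrite /Rintegral (cvg_unique _ h h0).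
Qed.

(** Monotone arguments give a change of variables for nonnegative functions; the
    positive and negative parts of G extend it to every sign, and both
    sides being defined as the difference of the integrals of these parts.
    The scalar s is used with the values 1 and -1. *)
Lemma integral_substitution_signed (A B : set R) F w G :
  (forall x, 0 <= w x) ->
  (forall s : R, \int[mu]_(x in A) (Num.max (s * G x) 0)%:E =
     \int[mu]_(x in B) (Num.max (s * G (F x)) 0 * w x)%:E)%E ->
  (\int[mu]_(x in A) (G x)%:E = \int[mu]_(x in B) (G (F x) * w x)%:E)%E.
Proof.
move=> w0 AB; rewrite integralE [RHS]integralE; congr (_ - _)%E.
  under eq_integral do rewrite funeposE -EFin_max -[X in Num.max X _]mul1r.
  rewrite AB; apply: eq_integral => x _.
  by rewrite funeposE -EFin_max mul1r maxr_pMl// mul0r.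
under eq_integral do rewrite funenegE -EFinN -EFin_max -[X in Num.max X _]mulN1r.
rewrite AB; apply: eq_integral => x _.
by rewrite funenegE -EFinN -EFin_max mulN1r maxr_pMl// mul0r mulNr.
Qed.

Lemma integral_affine G (r s : R) : 0 < r -> continuous G ->
  (\int[mu]_x (G x)%:E = \int[mu]_x (G (r * x + s)%R * r)%:E)%E.
Proof.
move=> r0 cG.
pose F x : R := r * x + s.
have dF x : is_derive (x : R) (1 : R) F r.
  have h : is_derive (x : R) (1 : R) (r *: (id : R -> R) + cst s) r.
    by apply: is_derive_eq; rewrite addr0 /GRing.scale /= mulr1.
  exact: h.
have dFE : (F^`())%classic = cst r.
  by apply/funext => x; rewrite derive1E; have [] := dF x.
apply: (@integral_substitution_signed _ _ F (cst r)) => [x|t]; first exact: ltW.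
pose H x := Num.max (t * G x) 0.
have : (\int[mu]_x (H x)%:E = \int[mu]_x (((H \o F) * F^`()%classic) x)%:E)%E.
  apply: increasing_ge0_integration_by_substitutionT; rewrite ?dFE.
  - by move=> x y xy; rewrite /F ltrD2r ltr_pM2l.
  - by move=> x; exact: cst_continuous.
  - exact: is_cvg_cst.
  - exact: is_cvg_cst.
  - by move=> x; have [] := dF x.
  - apply/cvgrNyPle => A; near=> x.
    rewrite /F -lerBrDr mulrC -ler_pdivlMr//; near: x; exact: nbhs_ninfty_le.
  - apply/cvgryPge => A; near=> x.
    rewrite /F -lerBlDr mulrC -ler_pdivrMr//; near: x; exact: nbhs_pinfty_ge.
  - move=> x; apply: (@continuous_max _ _ (fun x => t * G x) (cst 0)); last exact: cst_continuous.
    by apply: continuousM; [exact: cst_continuous|exact: cG].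
  - by move=> x; rewrite /H le_max lexx orbT.
by rewrite dFE.
Unshelve. all: by end_near.
Qed.

End line.

(** * The substitution t = exp u *)

Section exp_substitution.
Context {R : realType}.
Notation mu := (@lebesgue_measure R).

Lemma bigcup_exp_symitv :
  \bigcup_n `[expR (- n%:R), expR n%:R]%classic = `]0, +oo[%classic :> set R.
Proof.
apply/seteqP; split => [x [n _] /=|x /=]; rewrite !in_itv/= ?andbT.
  by case/andP => + _; apply: lt_le_trans; exact: expR_gt0.
move=> x0; have : [set: R] (ln x) by [].
rewrite -bigcup_symitv => -[n _]; rewrite /symitv /= in_itv/= => /andP[h1 h2].
by exists n => //=; rewrite in_itv/= -(lnK x0) !ler_expR h1.
Qed.

Lemma nondecreasing_exp_symitv :
  {homo (fun n => `[expR (- n%:R), expR n%:R]%classic : set R) :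
    m n / (m <= n)%N >-> (m <= n)%O}.
Proof.
move=> m n mn; apply/subsetPset/subset_itvScc => //.
  by rewrite bnd_simp ler_expR lerN2 ler_nat.
by rewrite bnd_simp ler_expR ler_nat.
Qed.

(** On [-n, n] this is the substitution rule for bounded intervals; both sides
    increase to the integrals over the whole domains. *)
Lemma ge0_integral_expR (G : R -> R) :
  {in `]0, +oo[, continuous G} -> (forall x, 0 <= G x) ->
  (\int[mu]_(x in `]0%R, +oo[) (G x)%:E =
   \int[mu]_x (G (expR x) * expR x)%:E)%E.
Proof.
move=> cG G0.
have cGe : continuous (fun x => G (expR x) * expR x).
  move=> x; apply: continuousM; last exact: continuous_expR.
  apply: continuous_comp; first exact: continuous_expR.
  by apply: cG; rewrite in_itv/= expR_gt0.
have dE : (@expR R)^`()%classic = @expR R.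
  by apply/funext => x; rewrite derive1E derive_val.
have eqn n : (\int[mu]_(x in `[expR (- n%:R), expR n%:R]) (G x)%:E =
    \int[mu]_(x in symitv n) (G (expR x) * expR x)%:E)%E.
  rewrite integration_by_substitution_increasing ?dE//.
  - by rewrite (@le_trans _ _ 0)// oppr_le0.
  - by move=> x y _ _; rewrite ltr_expR.
  - by move=> x _; exact: continuous_expR.
  - by apply: cvgP; apply: cvg_at_right_filter; exact: continuous_expR.
  - by apply: cvgP; apply: cvg_at_left_filter; exact: continuous_expR.
  - split; first by move=> x _.
    + by apply: cvg_at_right_filter; exact: continuous_expR.
    + by apply: cvg_at_left_filter; exact: continuous_expR.
  - apply: continuous_in_subspaceT => x; rewrite inE/= in_itv/= => /andP[x0 _].
    by apply: cG; rewrite in_itv/= andbT (lt_le_trans _ x0)// expR_gt0.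
have mG : measurable_fun (`]0, +oo[%classic : set R) G.
  by apply: open_continuous_measurable_fun => // x; rewrite inE; exact: cG.
rewrite -bigcup_exp_symitv -bigcup_symitv.
have c1 : (\int[mu]_(x in `[expR (- n%:R), expR n%:R]) (G x)%:E)%E @[n --> \oo] -->
    (\int[mu]_(x in \bigcup_n `[expR (- n%:R), expR n%:R]%classic) (G x)%:E)%E.
  apply: ge0_nondecreasing_set_cvg_integral => //.
  - exact: nondecreasing_exp_symitv.
  - move=> n; apply/measurable_EFinP.
    apply: measurable_funS mG => //; rewrite -bigcup_exp_symitv.
    exact: (@bigcup_sup _ _ n).
  - by move=> n x _; rewrite lee_fin.
have c2 : (\int[mu]_(x in symitv n) (G (expR x) * expR x)%:E)%E @[n --> \oo] -->
    (\int[mu]_(x in \bigcup_n symitv n) (G (expR x) * expR x)%:E)%E.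
  apply: ge0_nondecreasing_set_cvg_integral => //.
  - exact: nondecreasing_symitv.
  - by move=> n; exact: measurable_itv.
  - move=> n; apply/measurable_EFinP/measurable_funTS.
    exact: continuous_measurable_fun.
  - by move=> n x _; rewrite lee_fin mulr_ge0// expR_ge0.
have {}c1 : (\int[mu]_(x in symitv n) (G (expR x) * expR x)%:E)%E @[n --> \oo] -->
    (\int[mu]_(x in \bigcup_n `[expR (- n%:R), expR n%:R]%classic) (G x)%:E)%E.
  by under eq_fun do rewrite -eqn.
exact: cvg_unique c1 c2.
Qed.

Lemma integral_expR (G : R -> R) : {in `]0, +oo[, continuous G} ->
  (\int[mu]_(x in `]0%R, +oo[) (G x)%:E =
   \int[mu]_x (G (expR x) * expR x)%:E)%E.
Proof.
move=> cG; apply: integral_substitution_signed => [x|s]; first exact: expR_ge0.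
apply: (@ge0_integral_expR (fun x => Num.max (s * G x) 0)) => [x x0|x].
  apply: (@continuous_max _ _ (fun x => s * G x) (cst 0)).
    by apply: continuousM; [exact: cst_continuous|exact: cG].
  exact: cst_continuous.
by rewrite le_max lexx orbT.
Qed.

End exp_substitution.

(** * Euler's integral on the line *)

Section unimodular.
Context {R : realType}.
Implicit Types (x y : R) (z w : R[i]).

Definition expi x : R[i] := cos x +i* sin x.

Lemma expiD x y : expi (x + y) = expi x * expi y.
Proof. by rewrite /expi cosD sinD; congr (_ +i* _); rewrite addrC mulrC. Qed.

Lemma expi0 : expi 0 = 1. Proof. by rewrite /expi cos0 sin0. Qed.

Lemma expi_sum n (f : 'I_n -> R) :
  expi (\sum_(i < n) f i) = \prod_(i < n) expi (f i).
Proof. exact: (big_morph _ expiD expi0). Qed.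

Lemma cexp_imag x : cexp (- ('i * x%:C)) = expi (- x).
Proof.
have -> : - ('i * x%:C) = 0 +i* (- x).
  by apply/eqP; rewrite eq_complex /= !(mul0r, mulr0, mul1r) ?subr0 ?addr0 ?add0r oppr0 !eqxx.
by rewrite /cexp /= expR0 mul1r.
Qed.

Lemma cintegrable_expi d (T : measurableType d)
    (mu : {measure set T -> \bar R}) (h th : T -> R) :
  mu.-integrable setT (EFin \o h) -> measurable_fun setT th ->
  cintegrable mu (fun t => (h t)%:C * expi (th t)).
Proof.
move=> hi mth; have /measurable_EFinP mh := measurable_int _ hi.
have osc (g : R -> R) : measurable_fun setT g -> (forall x, `|g x| <= 1) ->
    mu.-integrable setT (EFin \o (fun t => h t * g (th t))).
  move=> mg g1; apply: le_integrable hi => //.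
    by apply/measurable_EFinP/measurable_funM => //; exact: measurableT_comp.
  move=> x _ /=; rewrite lee_fin normrM ler_piMr//.
split.
  have h0 : mu.-integrable setT (EFin \o (fun t => h t * cos (th t))).
    apply: osc; first exact: continuous_measurable_fun (@continuous_cos R).
    by move=> x; rewrite ler_norml cos_geN1 cos_le1.
  by apply: eq_integrable h0 => // x _ /=; rewrite mul0r subr0.
have h0 : mu.-integrable setT (EFin \o (fun t => h t * sin (th t))).
  apply: osc; first exact: continuous_measurable_fun (@continuous_sin R).
  by move=> x; rewrite ler_norml sin_geN1 sin_le1.
by apply: eq_integrable h0 => // x _ /=; rewrite mul0r addr0.
Qed.

End unimodular.

Section gamma.
Context {R : realType}.
Notation mu := (@lebesgue_measure R).
Implicit Types (p q u x : R).

(** The modulus of the integrand of Gamma(p + i q) after t = exp u. *)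
Definition gamma_kernel p u : R := expR (p * u - expR u).

(** The tail at +oo uses exp u >= (1 + u/2)^2, hence
    p u - exp u <= (p + 1)^2 - 2 u; the tail at -oo uses exp (- p u) >=
    (1 - p u / 2)^2.  Both then beat 1 + u^2, whose inverse has the bounded
    primitive atan. *)
Lemma gamma_kernel_bound p : 0 < p ->
  forall u, gamma_kernel p u <=
    expR ((p + 1) ^+ 2) * (1 + 4 / p ^+ 2) * (1 + u ^+ 2)^-1.
Proof.
move=> p0 u; have p2 : 0 < p ^+ 2 by rewrite exprn_gt0.
have c1 : 1 <= expR ((p + 1) ^+ 2) by rewrite -expR0 ler_expR sqr_ge0.
have c2 : 0 < 4 / p ^+ 2 by rewrite divr_gt0.
have u2 : 0 < 1 + u ^+ 2 by rewrite ltr_pwDl// sqr_ge0.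
rewrite ler_pdivlMr// /gamma_kernel.
have [u0|u0] := leP 0 u.
  rewrite (@le_trans _ _ (expR ((p + 1) ^+ 2)))//; last first.
    by rewrite ler_peMr ?expR_ge0// lerDl ltW.
  have e2 : 1 + u ^+ 2 <= expR (2 * u).
    rewrite (mulrC 2) expRM_natr (@le_trans _ _ ((1 + u) ^+ 2))//; first nra.
    by rewrite ler_sqr ?nnegrE ?addr_ge0 ?expR_ge0// expR_ge1Dx.
  rewrite (le_trans (ler_wpM2l (expR_ge0 _) e2))// -expRD ler_expR.
  have : (1 + u / 2) ^+ 2 <= expR u.
    have {2}-> : u = u / 2 * 2%:R by rewrite divfK.
    rewrite expRM_natr ler_sqr ?nnegrE ?addr_ge0 ?expR_ge0 ?expR_ge1Dx ?divr_ge0//.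
  have := sqr_ge0 (p + 1 - u / 2).
  lra.
have e1 : 1 + (p * u / 2) ^+ 2 <= expR (- (p * u)).
  have -> : - (p * u) = - (p * u) / 2 * 2%:R by rewrite divfK.
  have pu : 0 <= - (p * u) / 2 by rewrite divr_ge0// oppr_ge0; nra.
  rewrite expRM_natr (@le_trans _ _ ((1 + - (p * u) / 2) ^+ 2))//; first nra.
  by rewrite ler_sqr ?nnegrE ?addr_ge0 ?expR_ge0 ?expR_ge1Dx.
have e3 : expR (p * u - expR u) * (1 + (p * u / 2) ^+ 2) <= 1.
  rewrite (le_trans (ler_wpM2l (expR_ge0 _) e1))// -expRD.
  by rewrite -expR0 ler_expR addrAC subrr sub0r oppr_le0 expR_ge0.
have e4 : 1 + u ^+ 2 <= (1 + 4 / p ^+ 2) * (1 + (p * u / 2) ^+ 2).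
  have -> : (p * u / 2) ^+ 2 = p ^+ 2 * u ^+ 2 / 4 by field.
  have : 4 / p ^+ 2 * (p ^+ 2 * u ^+ 2 / 4) = u ^+ 2.
    by field; rewrite gt_eqF.
  have : 0 <= p ^+ 2 * u ^+ 2 / 4 by rewrite divr_ge0// mulr_ge0// sqr_ge0.
  nra.
rewrite (le_trans (ler_wpM2l (expR_ge0 _) e4))// mulrCA.
rewrite (@le_trans _ _ (1 + 4 / p ^+ 2))//.
  by rewrite -[leRHS]mulr1 ler_wpM2l// addr_ge0// ltW.
by rewrite ler_peMl// addr_ge0// ltW.
Qed.

Lemma integrable_oneDsqrV :
  mu.-integrable setT (EFin \o (fun x : R => (1 + x ^+ 2)^-1)).
Proof.
have D x : 1 + x ^+ 2 != 0 :> R by rewrite gt_eqF// ltr_pwDl// sqr_ge0.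
apply: (@integrable_bounded_primitive _ atan _ (pi / 2)).
- move=> x; apply: cvgV => //; apply: cvgD; first exact: cvg_cst.
  exact: exprn_continuous.
- by move=> x; rewrite invr_ge0 addr_ge0// sqr_ge0.
- by move=> x; rewrite ler_norml !ltW ?atan_gtNpi2 ?atan_ltpi2.
Qed.

Lemma continuous_gamma_kernel p : continuous (gamma_kernel p).
Proof.
move=> u; apply: (@continuous_comp _ _ _ (fun u => p * u - expR u) expR).
  apply: continuousB; last exact: continuous_expR.
  by apply: continuousM; [exact: cst_continuous|].
exact: continuous_expR.
Qed.

Lemma measurable_gamma_kernel p : measurable_fun setT (gamma_kernel p).
Proof. exact: (continuous_measurable_fun (@continuous_gamma_kernel p)). Qed.

Lemma gamma_kernel_ge0 p u : 0 <= gamma_kernel p u.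
Proof. exact: expR_ge0. Qed.

Lemma integrable_gamma_kernel p : 0 < p ->
  mu.-integrable setT (EFin \o gamma_kernel p).
Proof.
move=> p0; have := integrable_oneDsqrV.
move/(integrableZl measurableT (expR ((p + 1) ^+ 2) * (1 + 4 / p ^+ 2))).
apply: le_integrable => //.
  by apply/measurable_EFinP; exact: measurable_gamma_kernel.
move=> u _ /=; rewrite lee_fin ger0_norm ?gamma_kernel_ge0//.
by rewrite (le_trans (gamma_kernel_bound p0 u))// ler_norm.
Qed.

Lemma cintegrable_gamma p q : 0 < p ->
  cintegrable mu (fun u => (gamma_kernel p u)%:C * expi (q * u)).
Proof.
move=> p0; apply: cintegrable_expi; first exact: integrable_gamma_kernel.
exact: measurable_funM.
Qed.

(** The factor t^(-1) of Euler's integral is absorbed by dt = exp u du, so that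
    p u replaces (p - 1) ln t. *)
Lemma cgammaE p q : cgamma (p +i* q) =
  cintegral mu setT (fun u => (gamma_kernel p u)%:C * expi (q * u)).
Proof.
have E (g : R -> R) : continuous g ->
  \int[mu]_(t in `]0, +oo[) (expR ((p - 1) * ln t - t) * g (q * ln t)) =
  \int[mu]_u (gamma_kernel p u * g (q * u)).
  move=> cg.
  have cG : {in `]0, +oo[, continuous
      (fun t : R => expR ((p - 1) * ln t - t) * g (q * ln t))}.
    move=> t; rewrite in_itv/= andbT => t0.
    apply: (@continuousM R R (fun t : R => expR ((p - 1) * ln t - t)) (fun t : R => g (q * ln t))) => /=.
      apply: (@continuous_comp _ _ _ (fun t => (p - 1) * ln t - t) expR).
        apply: continuousB; last exact: cvg_id.
        apply: continuousM.
          exact: cst_continuous.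
        exact: continuous_ln.
      exact: continuous_expR.
    apply: (@continuous_comp _ _ _ (fun t => q * ln t) g); last exact: cg.
    by apply: continuousM; [exact: cst_continuous|exact: continuous_ln].
  rewrite /Rintegral (integral_expR cG); congr fine; apply: eq_integral => u _.
  rewrite expRK mulrAC -expRD /gamma_kernel; congr (expR _ * _)%:E; ring.
rewrite /cgamma /cintegral; congr (_ +i* _).
  transitivity (\int[mu]_(t in `]0, +oo[)
      (expR ((p - 1) * ln t - t) * cos (q * ln t))).
    apply: eq_Rintegral => t _.
    rewrite expRD /= !(subr0, mulr0, mul0r, addr0, add0r).
    by rewrite mulrAC.
  rewrite (E _ (@continuous_cos R)).
  by apply: eq_Rintegral => u _ /=; rewrite mul0r subr0.
transitivity (\int[mu]_(t in `]0, +oo[)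
    (expR ((p - 1) * ln t - t) * sin (q * ln t))).
  apply: eq_Rintegral => t _.
  rewrite expRD /= !(subr0, mulr0, mul0r, addr0, add0r).
  by rewrite mulrAC.
rewrite (E _ (@continuous_sin R)).
by apply: eq_Rintegral => u _ /=; rewrite mul0r addr0.
Qed.

End gamma.

(** * Recursion and positivity of the Gamma function *)

Section gamma_recursion.
Context {R : realType}.
Notation mu := (@lebesgue_measure R).
Implicit Types (p q u x : R).

Lemma gamma_kernelD1 p u : gamma_kernel (p + 1) u = gamma_kernel p u * expR u.
Proof. by rewrite /gamma_kernel -expRD; congr expR; ring. Qed.

Lemma is_derive_gamma_kernel p u : is_derive (u : R) (1 : R) (gamma_kernel p)
  (p * gamma_kernel p u - gamma_kernel (p + 1) u).
Proof.
have h : is_derive (u : R) (1 : R)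
    ((@expR R) \o (p *: (id : R -> R) - @expR R))
    (p * gamma_kernel p u - gamma_kernel (p + 1) u).
  apply: is_derive_eq.
  rewrite gamma_kernelD1 /= /gamma_kernel /GRing.scale /= mulr1.
  rewrite mulrBr mulrC; congr (_ - _ * _).
exact: h.
Qed.

(** The condition on squares covers both ends of the line, s n = n and
    s n = - n, at which the primitive has to vanish. *)
Lemma cvg_gamma_kernel_osc p (g : R -> R) (s : nat -> R) : 0 < p ->
  (forall x, `|g x| <= 1) -> (forall n, s n ^+ 2 = n%:R ^+ 2) ->
  gamma_kernel p (s n) * g (s n) @[n --> \oo] --> 0.
Proof.
move=> p0 g1 sn; pose C := expR ((p + 1) ^+ 2) * (1 + 4 / p ^+ 2).
have C0 : 0 <= C by rewrite mulr_ge0 ?expR_ge0// addr_ge0// divr_ge0// sqr_ge0.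
apply: norm_cvg0.
apply: (@squeeze_cvgr _ _ _ _ (cst 0) (fun n => C * harmonic n)).
- apply: nearW => n; rewrite normr_ge0/= normrM ger0_norm ?gamma_kernel_ge0//.
  rewrite (le_trans (ler_piMr (gamma_kernel_ge0 _ _) (g1 _)))//.
  rewrite (le_trans (gamma_kernel_bound p0 _))// ler_wpM2l// sn.
  rewrite /= lef_pV2 ?posrE ?ltr0n ?ltr_pwDl ?sqr_ge0//.
  by rewrite -addn1 natrD addrC lerD2l -natrX ler_nat; case: n => // m; rewrite -mulnn leq_pmulr.
- exact: cvg_cst.
- by rewrite -(mulr0 C); apply: cvgM; [exact: cvg_cst|exact: cvg_harmonic].
Qed.

(** The derivative of exp (p u - exp u) g (q u) integrates to 0 over the line.
    The pairs (cos, - sin) and (sin, cos) for (g, dg) give the two components of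
    the recursion of the Gamma function. *)
Lemma gamma_kernel_by_parts p q (g dg : R -> R) : 0 < p ->
  (forall x : R, is_derive x (1 : R) g (dg x)) ->
  continuous g -> continuous dg ->
  (forall x, `|g x| <= 1) -> (forall x, `|dg x| <= 1) ->
  \int[mu]_u (gamma_kernel (p + 1) u * g (q * u)) =
  p * \int[mu]_u (gamma_kernel p u * g (q * u)) +
  q * \int[mu]_u (gamma_kernel p u * dg (q * u)).
Proof.
move=> p0 dgE cg cdg g1 dg1.
have osc r (h : R -> R) : 0 < r -> continuous h -> (forall x, `|h x| <= 1) ->
    mu.-integrable setT (EFin \o (fun u => gamma_kernel r u * h (q * u))).
  move=> r0 ch h1; have := integrable_gamma_kernel r0.
  apply: le_integrable => //.
    apply/measurable_EFinP/measurable_funM.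
      exact: continuous_measurable_fun (@continuous_gamma_kernel R r).
    apply: measurableT_comp; first exact: continuous_measurable_fun.
    exact: measurable_funM.
  by move=> u _ /=; rewrite lee_fin normrM ler_piMr.
have i1 := osc _ _ (addr_gt0 p0 ltr01) cg g1.
have i2 := osc _ _ p0 cg g1.
have i3 := osc _ _ p0 cdg dg1.
pose F u := gamma_kernel p u * g (q * u).
pose f u := p * (gamma_kernel p u * g (q * u)) +
  q * (gamma_kernel p u * dg (q * u)) - gamma_kernel (p + 1) u * g (q * u).
have Z (r : R) (h : R -> R) : mu.-integrable setT (EFin \o h) ->
    mu.-integrable setT (EFin \o (fun x => r * h x)).
  by move=> /(integrableZl measurableT r); apply: eq_integrable.
have D (h k : R -> R) : mu.-integrable setT (EFin \o h) ->
    mu.-integrable setT (EFin \o k) ->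
    mu.-integrable setT (EFin \o (fun x => h x + k x)).
  by move=> hi ki; have := integrableD measurableT hi ki; apply: eq_integrable.
have fi : mu.-integrable setT (EFin \o f).
  have := integrableB measurableT (D _ _ (Z p _ i2) (Z q _ i3)) i1.
  by apply: eq_integrable.
have comp (h : R -> R) : continuous h -> continuous (fun u => h (q * u)).
  move=> ch u; apply: (@continuous_comp _ _ _ (fun u => q * u) h); last exact: ch.
  by apply: continuousM; [exact: cst_continuous|].
have ck r (h : R -> R) : continuous h ->
    continuous (fun u => gamma_kernel r u * h (q * u)).
  move=> ch u; apply: (@continuousM R R (gamma_kernel r) (fun u => h (q * u))).
    exact: continuous_gamma_kernel.
  exact: comp.
have cf : continuous f.
  have cZ r (h : R -> R) : continuous h -> continuous (fun u => r * h u).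
    by move=> ch u; apply: continuousM; [exact: cst_continuous|exact: ch].
  move=> u; apply: (@continuousB _ R _ (fun u => p * (gamma_kernel p u * g (q * u)) +
    q * (gamma_kernel p u * dg (q * u)))); last exact: ck.
  apply: (@continuousD _ R _ (fun u => p * (gamma_kernel p u * g (q * u)))).
    exact/cZ/ck.
  exact/cZ/ck.
have dF x : is_derive (x : R) (1 : R) F (f x).
  have dq : is_derive (x : R) (1 : R) (q *: (id : R -> R)) q.
    by apply: is_derive_eq; rewrite /GRing.scale /= mulr1.
  have dgq := @is_derive1_comp R g (q *: (id : R -> R)) x _ _ (dgE _) dq.
  have h : is_derive (x : R) (1 : R) (gamma_kernel p * (g \o (q *: (id : R -> R)))) (f x).
    have := is_deriveM (is_derive_gamma_kernel p x) dgq.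
    move=> /is_derive_eq; apply; rewrite /f /GRing.scale /=; ring.
  exact: h.
have /eqP : \int[mu]_u f u = 0.
  apply: (Rintegral_derivative_eq0 dF cf fi).
  - exact: (@cvg_gamma_kernel_osc p (fun u => g (q * u)) (fun n => n%:R)).
  - apply: (@cvg_gamma_kernel_osc p (fun u => g (q * u)) (fun n => - n%:R)) => //.
    by move=> n; rewrite sqrrN.
rewrite /f RintegralB//; last by apply: D; exact: Z.
rewrite RintegralD//; [|exact: Z|exact: Z].
by rewrite !RintegralZl// subr_eq0 => /eqP.
Qed.

Lemma cgamma_kernelE p q : cgamma (p +i* q) =
  (\int[mu]_u (gamma_kernel p u * cos (q * u))) +i*
  (\int[mu]_u (gamma_kernel p u * sin (q * u))).
Proof.
rewrite cgammaE /cintegral; congr (_ +i* _); apply: eq_Rintegral => u _ /=.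
  by rewrite mul0r subr0.
by rewrite mul0r addr0.
Qed.

Lemma cgammaD1 p q : 0 < p ->
  cgamma ((p + 1) +i* q) = (p +i* q) * cgamma (p +i* q).
Proof.
move=> p0; rewrite !cgamma_kernelE; congr (_ +i* _).
  rewrite (@gamma_kernel_by_parts _ _ cos (fun x => - sin x)) => //.
  - congr (_ + _).
    under eq_Rintegral do rewrite mulrN -mulN1r.
    rewrite RintegralZl//; first by rewrite mulN1r mulrN.
    by case: (@cintegrable_gamma R p q p0) => _; apply: eq_integrable => // u _ /=;
      rewrite mul0r addr0.
  - exact: continuous_cos.
  - by move=> x; apply: continuousN; exact: continuous_sin.
  - by move=> x; rewrite ler_norml cos_geN1 cos_le1.
  - by move=> x; rewrite normrN ler_norml sin_geN1 sin_le1.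
rewrite (@gamma_kernel_by_parts _ _ sin cos) => //.
- exact: continuous_sin.
- exact: continuous_cos.
- by move=> x; rewrite ler_norml sin_geN1 sin_le1.
- by move=> x; rewrite ler_norml cos_geN1 cos_le1.
Qed.

Lemma cgammaR p : cgamma p%:C = (\int[mu]_u gamma_kernel p u)%:C.
Proof.
rewrite -[p%:C]/(p +i* 0) cgamma_kernelE; congr (_ +i* _).
  by apply: eq_Rintegral => u _; rewrite mul0r cos0 mulr1.
rewrite /Rintegral; under eq_integral do rewrite mul0r sin0 mulr0.
by rewrite integral0.
Qed.

(** On [0, 1] the kernel is at least exp (- exp 1).  Positivity allows the
    division by Gamma(p + q) in the beta integral. *)
Lemma Rintegral_gamma_kernel_gt0 p : 0 < p -> 0 < \int[mu]_u gamma_kernel p u.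
Proof.
move=> p0; have gi := integrable_gamma_kernel p0.
have /measurable_EFinP mk := measurable_int _ gi.
have i0 : (0 < \int[mu]_u (gamma_kernel p u)%:E)%E.
  apply: (@lt_le_trans _ _ (\int[mu]_(u in `[0%R, 1%R]) (gamma_kernel p u)%:E)%E).
    apply: (@lt_le_trans _ _ (\int[mu]_(u in `[0%R, 1%R]) (cst (expR (- expR 1))%:E u))%E).
      rewrite integral_cst//= lebesgue_measure_itv/= lte_fin ltr01 oppr0 adde0 mule1.
      by rewrite lte_fin expR_gt0.
    apply: ge0_le_integral => //.
    - by move=> x _; rewrite lee_fin expR_ge0.
    - by apply/measurable_EFinP; exact: measurable_funTS.
    - move=> x /=; rewrite in_itv/= => /andP[x0 x1].
      rewrite lee_fin ler_expR -[leLHS]add0r; apply: lerD.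
        exact: mulr_ge0 (ltW p0) x0.
      by rewrite lerN2 ler_expR.
  apply: ge0_subset_integral => //.
    by apply/measurable_EFinP.
  by move=> x _; rewrite lee_fin gamma_kernel_ge0.
rewrite /Rintegral fine_gt0// i0/=.
by have := integrable_fin_num measurableT gi; rewrite fin_numElt => /andP[].
Qed.

Lemma cgammaR_neq0 p : 0 < p -> cgamma p%:C != 0.
Proof.
by move=> p0; rewrite cgammaR fmorph_eq0 gt_eqF// Rintegral_gamma_kernel_gt0.
Qed.

End gamma_recursion.

(** * The beta integral on the line *)

Section beta.
Context {R : realType}.
Notation mu := (@lebesgue_measure R).
Implicit Types (p q t u v x xi : R).

Lemma integrable_affine (G : R -> R) (r s : R) : 0 < r -> continuous G ->
  mu.-integrable setT (EFin \o G) ->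
  mu.-integrable setT (EFin \o (fun t => G (r * t + s) * r)).
Proof.
move=> r0 cG Gi.
have cGa : continuous (fun t => G (r * t + s) * r).
  move=> t; apply: continuousM; last exact: cst_continuous.
  apply: (@continuous_comp _ _ _ (fun t => r * t + s) G); last exact: cG.
  apply: continuousD; last exact: cst_continuous.
  by apply: continuousM; [exact: cst_continuous|].
apply/integrableP; split.
  by apply/measurable_EFinP; exact: continuous_measurable_fun.
have /integrableP[_] := Gi; rewrite (@integral_affine R (fun x => `|G x|) r s)//.
  by under [X in (_ -> X < _)%E]eq_integral do rewrite /= normrM (gtr0_norm r0).
by move=> x; apply: continuous_comp; [exact: cG|exact: norm_continuous].
Qed.

Lemma cintegral_affine (f : R -> R[i]) (r s : R) : 0 < r ->
  continuous (fun x => complex.Re (f x)) ->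
  continuous (fun x => complex.Im (f x)) ->
  cintegral mu setT (fun t => f (r * t + s) * r%:C) = cintegral mu setT f.
Proof.
move=> r0 cr ci; rewrite /cintegral; congr (_ +i* _).
  rewrite /Rintegral (integral_affine s r0 cr); congr fine.
  by apply: eq_integral => t _; case: (f _) => x y /=; rewrite mulr0 subr0.
rewrite /Rintegral (integral_affine s r0 ci); congr fine.
by apply: eq_integral => t _; case: (f _) => x y /=; rewrite mulr0 add0r mulrC.
Qed.

Definition softplus t : R := ln (1 + expR (2 * t)).

Lemma expR_softplus t : expR (softplus t) = 1 + expR (2 * t).
Proof. by rewrite lnK// posrE addr_gt0// expR_gt0. Qed.

(** Up to the factor 2^(p+q) this is (1 + tanh t)^p (1 - tanh t)^q; see
    [tanh_weightE]. *)
Definition beta_kernel p q t : R := expR (2 * p * t - (p + q) * softplus t).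

(** The map (t, v) -> (2 t + v, v), of Jacobian 2, separates the variables of a
    product of two gamma kernels up to a shift of v, because
    exp (2 t + v) + exp v = exp (v + softplus t). *)
Lemma gamma_kernel_prod p q t v :
  gamma_kernel p (2 * t + v) * 2 * gamma_kernel q v =
  2 * beta_kernel p q t * gamma_kernel (p + q) (1 * v + softplus t).
Proof.
rewrite mulrAC mulrC -[RHS]mulrA; congr (_ * _).
rewrite /gamma_kernel /beta_kernel -!expRD; congr expR.
by rewrite !(mul1r, expRD) expR_softplus; ring.
Qed.

(** Both sides are iterated integrals of the same function K(t, v) e^(-i xi t):
    first over t, the inner integral is Gamma(p - i xi/2) by the substitution
    u = 2 t + v; first over v, it is Gamma(p + q) times the beta kernel by the
    shift of v.  Integrability of the beta kernel comes out of the same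
    computation, as a section integral of K. *)
Lemma beta_integral p q xi : 0 < p -> 0 < q ->
  mu.-integrable setT (EFin \o beta_kernel p q) /\
  cintegral mu setT (fun t => (beta_kernel p q t)%:C * expi (- (xi * t))) *
    (2 * cgamma (p + q)%:C) =
  cgamma (p +i* (- (xi / 2))) * cgamma (q +i* (xi / 2)).
Proof.
move=> p0 q0; have pq0 := addr_gt0 p0 q0.
have ck r : continuous (gamma_kernel r) := @continuous_gamma_kernel R r.
have mk := @measurable_gamma_kernel R.
pose K (z : measurableTypeR R * measurableTypeR R) : R :=
  gamma_kernel p (2 * z.1 + z.2) * 2 * gamma_kernel q z.2.
have mK : measurable_fun setT K.
  apply: measurable_funM; last exact: (measurableT_comp (mk q) measurable_snd).
  apply: measurable_funM => //.
  apply: (@measurableT_comp _ _ _ _ _ _ (gamma_kernel p) _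
           (fun z : measurableTypeR R * measurableTypeR R => 2 * z.1 + z.2)) => //.
  by apply: measurable_funD => //; exact: measurable_funM.
have ia r s c : 0 < r -> 0 < c ->
    mu.-integrable setT (EFin \o (fun t => gamma_kernel r (c * t + s) * c)).
  by move=> r0 c0; exact: (integrable_affine s c0 (ck r) (integrable_gamma_kernel r0)).
have Kv v : mu.-integrable setT (EFin \o (fun t => K (t, v))).
  have := integrableZl measurableT (gamma_kernel q v)
    (ia p v 2 p0 (ltr0n R 2)).
  by apply: eq_integrable => // t _ /=; rewrite -EFinM mulrC.
have Kt t : mu.-integrable setT (EFin \o (fun v => K (t, v))).
  have := integrableZl measurableT (2 * beta_kernel p q t)
    (ia _ (softplus t) 1 pq0 ltr01).
  by apply: eq_integrable => // v _ /=; rewrite -EFinM mulr1 /K gamma_kernel_prod.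
pose G r := \int[mu]_u gamma_kernel r u.
have GE r : 0 < r -> (\int[mu]_u (gamma_kernel r u)%:E = (G r)%:E)%E.
  by move=> r0; rewrite /G /Rintegral fineK// (integrable_fin_num _ (integrable_gamma_kernel r0)).
have intKv v : (\int[mu]_t (K (t, v))%:E = (G p * gamma_kernel q v)%:E)%E.
  rewrite /K /=; under eq_integral do rewrite EFinM.
  rewrite integralZr//; last exact: (ia p v 2 p0 (ltr0n R 2)).
  by rewrite -(integral_affine v _ (ck p))// GE.
have intKt t : (\int[mu]_v (K (t, v))%:E =
    (2 * beta_kernel p q t * G (p + q))%:E)%E.
  rewrite /K /=; under eq_integral => v _.
    rewrite gamma_kernel_prod -[X in _ * X]mulr1 EFinM; over.
  rewrite integralZl//; last exact: (ia _ (softplus t) 1 pq0 ltr01).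
  by rewrite -(integral_affine (softplus t) _ (ck _))// GE.
have K0 z : 0 <= K z by rewrite mulr_ge0 ?gamma_kernel_ge0// mulr_ge0// gamma_kernel_ge0.
have Ki : (mu \x mu)%E.-integrable setT (EFin \o K).
  apply/integrable21ltyP; first exact/measurable_EFinP.
  under eq_integral => v _.
    under eq_integral => t _ do rewrite /= ger0_norm ?K0//.
    rewrite intKv; over.
  apply: integrable_lty => //.
  exact: (integrableZl measurableT (G p) (integrable_gamma_kernel q0)).
have Gpq : 0 < G (p + q) by exact: Rintegral_gamma_kernel_gt0.
(* The integral of K over v is the beta kernel times 2 Gamma(p + q). *)
have bi : mu.-integrable setT (EFin \o beta_kernel p q).
  have := integrableZl measurableT ((2 * G (p + q))^-1) (integrable_fubini_F Ki).
  apply: eq_integrable => // t _; rewrite /fubini_F intKt /= -EFinM.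
  by congr EFin; field; rewrite gt_eqF.
split=> //.
pose H (z : measurableTypeR R * measurableTypeR R) := (K z)%:C * expi (- (xi * z.1)).
have mxi : measurable_fun setT (fun t => - (xi * t)).
  by apply: measurableT_comp => //; exact: measurable_funM.
have Hi : cintegrable (mu \x mu)%E H.
  apply: (@cintegrable_expi _ _ _ _ K (fun z => - (xi * z.1))) => //.
  exact: (measurableT_comp mxi measurable_fst).
have Ht t : cintegrable mu (fun v => H (t, v)).
  exact: (cintegrable_expi (Kt t) (measurable_cst (- (xi * t)))).
have Hv v : cintegrable mu (fun t => H (t, v)) by exact: (cintegrable_expi (Kv v) mxi).
have := cintegral_fubini Hi Ht Hv.
have -> : (fun t => cintegral mu setT (fun v => H (t, v))) =
    (fun t => (2 * G (p + q))%:C * ((beta_kernel p q t)%:C * expi (- (xi * t)))).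
  apply/funext => t; rewrite /H /=; under eq_fun do rewrite mulrC.
  rewrite cintegralZ; last exact: cintegrableC (Kt t).
  rewrite cintegralC /Rintegral intKt /= !rmorphM /=; ring.
rewrite cintegralZ; last exact: cintegrable_expi bi mxi.
rewrite cgammaR -/(G _) rmorphM rmorph_nat mulrC => ->.
pose f u := (gamma_kernel p u)%:C * expi (- (xi / 2) * u).
have -> : (fun v => cintegral mu setT (fun t => H (t, v))) =
    (fun v => cgamma (p +i* (- (xi / 2))) *
              ((gamma_kernel q v)%:C * expi (xi / 2 * v))).
  apply/funext => v.
  have -> : (fun t => H (t, v)) = (fun t =>
      ((gamma_kernel q v)%:C * expi (xi / 2 * v)) * (f (2 * t + v) * 2%:C)).
    apply/funext => t; rewrite /H /K /f /=.
    have -> : - (xi * t) = xi / 2 * v + - (xi / 2) * (2 * t + v) by field.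
    by rewrite expiD !rmorphM /=; ring.
  rewrite cintegralZ; last first.
    have -> : (fun t => f (2 * t + v) * 2%:C) = (fun t =>
        (gamma_kernel p (2 * t + v) * 2)%:C * expi (- (xi / 2) * (2 * t + v))).
      by apply/funext => t; rewrite /f rmorphM /= mulrAC.
    refine (@cintegrable_expi R _ (measurableTypeR R) mu (fun t => gamma_kernel p (2 * t + v) * 2)
      (fun t => - (xi / 2) * (2 * t + v)) (ia p v 2 p0 (ltr0n R 2)) _).
    have m2 : measurable_fun setT (fun t : R => 2 * t + v).
      by apply: measurable_funD => //; exact: measurable_funM.
    by apply: (measurable_funM (measurable_cst _) m2).
  have cosc (g : R -> R) : continuous g ->
      continuous (fun u => gamma_kernel p u * g (- (xi / 2) * u)).
    move=> cg u; apply: (@continuousM R R (gamma_kernel p)); first exact: ck.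
    apply: (@continuous_comp _ _ _ (fun u => - (xi / 2) * u) g); last exact: cg.
    by apply: continuousM; [exact: cst_continuous|].
  rewrite cintegral_affine//; first by rewrite -cgammaE mulrC.
    rewrite /f /=; under eq_fun do rewrite mul0r subr0.
    exact: cosc (@continuous_cos R).
  rewrite /f /=; under eq_fun do rewrite mul0r addr0.
  exact: cosc (@continuous_sin R).
rewrite cintegralZ -?cgammaE//; exact: cintegrable_gamma.
Qed.
End beta.

(** * Terminating hypergeometric series and their tanh moments *)

Section hypergeometric_polynomials.
Context {K : numFieldType}.
Implicit Types (a x : K) (us ls : seq K).

Lemma pochhammerS a n : pochhammer a n.+1 = pochhammer a n * (a + n%:R).
Proof. by rewrite /pochhammer big_ord_recr. Qed.

Lemma pochhammer_neg N n : (N < n)%N -> pochhammer (- N%:R : K) n = 0.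
Proof.
by move=> Nn; rewrite /pochhammer (bigD1 (Ordinal Nn))//= addNr mul0r.
Qed.

Lemma pochhammer_neq0 a n : 0 < a -> pochhammer a n != 0.
Proof.
by move=> a0; apply/prodf_neq0 => i _; rewrite gt_eqF// ltr_wpDr.
Qed.

(** A negative integer upper parameter makes the partial sums stationary. *)
Lemma hypergeometric_neg N us ls x :
  hypergeometric (- N%:R :: us) ls x =
  \sum_(n < N.+1) (pochhammer (- N%:R) n * \prod_(u <- us) pochhammer u n) /
    (\prod_(l <- ls) pochhammer l n) * (x ^+ n / n`!%:R).
Proof.
apply: lim_near_cst; first exact: norm_hausdorff.
exists N.+1 => // m /= Nm.
rewrite /series /= big_mkord -(big_mkord xpredT (fun n =>
  (pochhammer (- N%:R) n * \prod_(u <- us) pochhammer u n) /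
  (\prod_(l <- ls) pochhammer l n) * (x ^+ n / n`!%:R))).
rewrite -(big_mkord xpredT (fun n => \prod_(u <- - N%:R :: us) pochhammer u n /
  \prod_(l <- ls) pochhammer l n * (x ^+ n / n`!%:R))).
rewrite (big_cat_nat _ Nm)//= [X in _ + X = _]big_nat [X in _ + X = _]big1 ?addr0.
  by apply: eq_bigr => n _; rewrite big_cons.
by move=> n /andP[Nn _]; rewrite big_cons pochhammer_neg// !mul0r.
Qed.

End hypergeometric_polynomials.

Lemma rmorph_pochhammer (K L : numFieldType) (f : {rmorphism K -> L}) a n :
  f (pochhammer a n) = pochhammer (f a) n.
Proof.
by rewrite /pochhammer rmorph_prod; apply: eq_bigr => i _; rewrite rmorphD rmorph_nat.
Qed.

Section tanh_weight.
Context {R : realType}.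
Notation mu := (@lebesgue_measure R).
Implicit Types (p q t x xi : R).

Lemma addr_tanh t : 1 + tanh t = 2 * expR (2 * t - softplus t).
Proof.
rewrite expRB expR_softplus /tanh expRN (mulrC 2 t) expRM_natr.
have : 0 < expR t by exact: expR_gt0.
move: (expR t) => e e0; field.
by rewrite !gt_eqF// addr_gt0// exprn_gt0.
Qed.

Lemma subr_tanh t : 1 - tanh t = 2 * expR (- softplus t).
Proof.
rewrite expRN expR_softplus /tanh expRN (mulrC 2 t) expRM_natr.
have : 0 < expR t by exact: expR_gt0.
move: (expR t) => e e0; field.
by rewrite !gt_eqF// addr_gt0// exprn_gt0.
Qed.

Lemma addr_tanh_gt0 t : 0 < 1 + tanh t.
Proof. by rewrite addr_tanh mulr_gt0// expR_gt0. Qed.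

Lemma subr_tanh_gt0 t : 0 < 1 - tanh t.
Proof. by rewrite subr_tanh mulr_gt0// expR_gt0. Qed.

Definition tanh_weight p q t : R := (1 + tanh t) `^ p * (1 - tanh t) `^ q.

Lemma tanh_weightE p q t : tanh_weight p q t = 2 `^ (p + q) * beta_kernel p q t.
Proof.
rewrite /tanh_weight addr_tanh subr_tanh !powRM ?expR_ge0// -!expRM.
rewrite mulrACA -powRD ?pnatr_eq0 ?implybT// -expRD; congr (_ * expR _); ring.
Qed.

Lemma tanh_weight_addX p q n t :
  tanh_weight p q t * ((1 + tanh t) / 2) ^+ n =
  2 ^- n * tanh_weight (p + n%:R) q t.
Proof.
rewrite /tanh_weight powRD ?(gt_eqF (addr_tanh_gt0 t)) ?implybT//.
by rewrite [in RHS]powR_mulrn ?ltW ?addr_tanh_gt0// expr_div_n; ring.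
Qed.

Lemma tanh_weight_subX p q n t :
  tanh_weight p q t * ((1 - tanh t) / 2) ^+ n =
  2 ^- n * tanh_weight p (q + n%:R) t.
Proof.
rewrite /tanh_weight [_ `^ (q + _)]powRD ?(gt_eqF (subr_tanh_gt0 t)) ?implybT//.
by rewrite [in RHS]powR_mulrn ?ltW ?subr_tanh_gt0// expr_div_n; ring.
Qed.

(** The value of the integral of e^(-i xi t) against [tanh_weight p q]. *)
Definition tanh_beta p q xi : R[i] :=
  (2 `^ (p + q - 1))%:C *
  (cgamma (p +i* (- (xi / 2))) * cgamma (q +i* (xi / 2)) / cgamma (p + q)%:C).

Lemma tanh_integral p q xi : 0 < p -> 0 < q ->
  mu.-integrable setT (EFin \o tanh_weight p q) /\
  cintegral mu setT (fun t => (tanh_weight p q t)%:C * expi (- (xi * t))) =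
  tanh_beta p q xi.
Proof.
move=> p0 q0; have [bi bE] := beta_integral xi p0 q0.
split.
  have := integrableZl measurableT (2 `^ (p + q)) bi.
  by apply: eq_integrable => // t _ /=; rewrite tanh_weightE EFinM.
have -> : (fun t => (tanh_weight p q t)%:C * expi (- (xi * t))) =
    (fun t => (2 `^ (p + q))%:C * ((beta_kernel p q t)%:C * expi (- (xi * t)))).
  by apply/funext => t; rewrite tanh_weightE rmorphM mulrA.
have mxi : measurable_fun setT (fun t => - (xi * t)).
  by apply: measurableT_comp => //; exact: measurable_funM.
rewrite cintegralZ; last exact: cintegrable_expi bi mxi.
rewrite /tanh_beta -bE [2 `^ (p + q - 1)]powRD ?pnatr_eq0 ?implybT// powRN powRr1// rmorphM /=.
rewrite fmorphV rmorph_nat; field.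
by rewrite cgammaR_neq0// addr_gt0.
Qed.

Lemma cgammaDn p (y : R) n : 0 < p ->
  cgamma ((p + n%:R) +i* y) = pochhammer (p +i* y) n * cgamma (p +i* y).
Proof.
move=> p0; elim: n => [|n ih]; first by rewrite addr0 /pochhammer big_ord0 mul1r.
rewrite pochhammerS -[in LHS]natr1 addrA cgammaD1 ?ltr_wpDr// ih mulrA.
rewrite [_ * pochhammer _ _]mulrC; congr (_ * _ * _).
by rewrite -(rmorph_nat (real_complex R)) /=; congr (_ +i* _); rewrite addr0.
Qed.

Lemma tanh_beta_addl p q xi n : 0 < p -> 0 < q ->
  (2 ^- n)%:C * tanh_beta (p + n%:R) q xi =
  tanh_beta p q xi *
    (pochhammer (p +i* (- (xi / 2))) n / pochhammer (p + q)%:C n).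
Proof.
move=> p0 q0; have pq0 := addr_gt0 p0 q0.
have h : cgamma (p + n%:R + q)%:C = pochhammer (p + q)%:C n * cgamma (p + q)%:C.
  by rewrite addrAC; exact: (cgammaDn 0 n pq0).
rewrite /tanh_beta cgammaDn// h.
have -> : p + n%:R + q - 1 = n%:R + (p + q - 1) by ring.
rewrite [2 `^ (n%:R + _)]powRD ?pnatr_eq0 ?implybT// powR_mulrn// rmorphM /= rmorphV ?unitfE ?expf_neq0//.
field.
apply/and3P; split; first by rewrite pochhammer_neq0// ltcR.
  exact: cgammaR_neq0.
by apply/eqP => /complexI/eqP; rewrite expf_eq0 pnatr_eq0 andbF.
Qed.

Lemma tanh_beta_addr p q xi n : 0 < p -> 0 < q ->
  (2 ^- n)%:C * tanh_beta p (q + n%:R) xi =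
  tanh_beta p q xi *
    (pochhammer (q +i* (xi / 2)) n / pochhammer (p + q)%:C n).
Proof.
move=> p0 q0; have pq0 := addr_gt0 p0 q0.
have h : cgamma (p + (q + n%:R))%:C = pochhammer (p + q)%:C n * cgamma (p + q)%:C.
  by rewrite addrA; exact: (cgammaDn 0 n pq0).
rewrite /tanh_beta (cgammaDn _ _ q0)// h.
have -> : p + (q + n%:R) - 1 = n%:R + (p + q - 1) by ring.
rewrite [2 `^ (n%:R + _)]powRD ?pnatr_eq0 ?implybT// powR_mulrn// rmorphM /= rmorphV ?unitfE ?expf_neq0//.
field.
apply/and3P; split; first by rewrite pochhammer_neq0// ltcR.
  exact: cgammaR_neq0.
by apply/eqP => /complexI/eqP; rewrite expf_eq0 pnatr_eq0 andbF.
Qed.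

(** Term by term integration of a 2F1 polynomial: the moments supply one more
    Pochhammer symbol above and one below. *)
Lemma cintegral_hypergeometric (w f : R -> R) xi N (u l : R) (c z m : R[i]) :
  (forall n, mu.-integrable setT (EFin \o (fun t => w t * f t ^+ n))) ->
  (forall n, cintegral mu setT (fun t => (w t * f t ^+ n)%:C * expi (- (xi * t))) =
     c * (pochhammer z n / pochhammer m n)) ->
  let g t := w t * hypergeometric [:: - N%:R; u] [:: l] (f t) in
  mu.-integrable setT (EFin \o g) /\
  cintegral mu setT (fun t => (g t)%:C * expi (- (xi * t))) =
  c * hypergeometric [:: - N%:R; u%:C; z] [:: l%:C; m] 1.
Proof.
move=> wi wE g.
pose k n : R := pochhammer (- N%:R) n * pochhammer u n / pochhammer l n / n`!%:R.
have gE t : g t = \sum_(n < N.+1) k n * (w t * f t ^+ n).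
  rewrite /g hypergeometric_neg mulr_sumr; apply: eq_bigr => n _.
  by rewrite /k !big_seq1; ring.
have mxi : measurable_fun setT (fun t => - (xi * t)).
  by apply: measurableT_comp => //; exact: measurable_funM.
have ei n : cintegrable mu (fun t => (w t * f t ^+ n)%:C * expi (- (xi * t))).
  exact: cintegrable_expi (wi n) mxi.
split.
  have ki n : cintegrable mu (fun t => (k n * (w t * f t ^+ n))%:C).
    apply: cintegrableC; have := integrableZl measurableT (k n) (wi n).
    exact: eq_integrable.
  have [+ _] := cintegrable_sum N.+1 ki.
  apply: eq_integrable => // t _ /=.
  by rewrite gE -(rmorph_sum (real_complex R)).
have -> : (fun t => (g t)%:C * expi (- (xi * t))) =
  (fun t => \sum_(n < N.+1) (k n)%:C * ((w t * f t ^+ n)%:C * expi (- (xi * t)))).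
  apply/funext => t; rewrite gE rmorph_sum mulr_suml; apply: eq_bigr => n _.
  by rewrite rmorphM mulrA.
rewrite (@cintegral_sum _ (measurableTypeR R) _ mu _ (fun n t =>
  (k n)%:C * ((w t * f t ^+ n)%:C * expi (- (xi * t))))); last first.
  by move=> n; exact: cintegrableZ.
rewrite hypergeometric_neg mulr_sumr; apply: eq_bigr => n _.
rewrite cintegralZ// wE /k !big_cons !big_nil expr1n !mulr1.
rewrite !rmorphM /= !fmorphV /= !rmorph_pochhammer/= rmorphN /= !rmorph_nat invfM.
by ring.
Qed.

End tanh_weight.

(** * Transforms of the Jacobi and Gegenbauer factors; powers and exponents *)

Section transforms.
Context {R : realType}.
Notation mu := (@lebesgue_measure R).
Implicit Types (p q a t x xi al ga la : R).

Lemma cintegrable_fourier (f : R -> R) xi : mu.-integrable setT (EFin \o f) ->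
  cintegrable mu (fun t => (f t)%:C * expi (- (xi * t))).
Proof.
move=> fi; have mxi : measurable_fun setT (fun t => - (xi * t)).
  by apply: measurableT_comp => //; exact: measurable_funM.
exact: cintegrable_expi fi mxi.
Qed.

Lemma cintegral_fourierZ (f : R -> R) r xi : mu.-integrable setT (EFin \o f) ->
  mu.-integrable setT (EFin \o (fun t => r * f t)) /\
  cintegral mu setT (fun t => (r * f t)%:C * expi (- (xi * t))) =
  r%:C * cintegral mu setT (fun t => (f t)%:C * expi (- (xi * t))).
Proof.
move=> fi; split.
  by have := integrableZl measurableT r fi; apply: eq_integrable.
rewrite -(cintegralZ _ (cintegrable_fourier xi fi)).
by congr (cintegral _ _ _); apply/funext => t; rewrite rmorphM mulrA.
Qed.

Lemma jacobi_transform p q al ga N xi : 0 < p -> 0 < q ->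
  mu.-integrable setT
    (EFin \o (fun t => tanh_weight p q t * jacobi al ga N (- tanh t))) /\
  cintegral mu setT (fun t =>
    (tanh_weight p q t * jacobi al ga N (- tanh t))%:C * expi (- (xi * t))) =
  (pochhammer (al + 1) N / N`!%:R)%:C * (tanh_beta p q xi *
    hypergeometric [:: - N%:R; (N%:R + al + ga + 1)%:C; p +i* (- (xi / 2))]
      [:: (al + 1)%:C; (p + q)%:C] 1).
Proof.
move=> p0 q0.
have pn n : 0 < p + n%:R by rewrite ltr_wpDr.
have wi n : mu.-integrable setT
    (EFin \o (fun t => tanh_weight p q t * ((1 + tanh t) / 2) ^+ n)).
  have [+ _] := tanh_integral xi (pn n) q0.
  move/(integrableZl measurableT (2 ^- n)).
  by apply: eq_integrable => // t _ /=; rewrite tanh_weight_addX EFinM.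
have [|hi hE] := cintegral_hypergeometric (xi := xi) (c := tanh_beta p q xi)
    (z := p +i* (- (xi / 2))) (m := (p + q)%:C) N (N%:R + al + ga + 1) (al + 1) wi.
  move=> n; have [ti tE] := tanh_integral xi (pn n) q0.
  rewrite -tanh_beta_addl// -tE.
  rewrite -(proj2 (cintegral_fourierZ (2 ^- n) xi ti)).
  by congr (cintegral _ _ _); apply/funext => t; rewrite tanh_weight_addX.
have [gi gE] := cintegral_fourierZ (pochhammer (al + 1) N / N`!%:R) xi hi; split.
  by apply: eq_integrable gi => // t _; rewrite /= /jacobi opprK mulrCA.
rewrite -hE -gE; congr (cintegral _ _ _); apply/funext => t.
by rewrite /jacobi opprK mulrCA.
Qed.

Lemma gegenbauer_transform p la N xi : 0 < p ->
  mu.-integrable setT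
    (EFin \o (fun t => tanh_weight p p t * gegenbauer la N (tanh t))) /\
  cintegral mu setT (fun t =>
    (tanh_weight p p t * gegenbauer la N (tanh t))%:C * expi (- (xi * t))) =
  (pochhammer (2 * la) N / N`!%:R)%:C * (tanh_beta p p xi *
    hypergeometric [:: - N%:R; (N%:R + 2 * la)%:C; p +i* (xi / 2)]
      [:: (la + 2^-1)%:C; (p + p)%:C] 1).
Proof.
move=> p0.
have pn n : 0 < p + n%:R by rewrite ltr_wpDr.
have wi n : mu.-integrable setT
    (EFin \o (fun t => tanh_weight p p t * ((1 - tanh t) / 2) ^+ n)).
  have [+ _] := tanh_integral xi p0 (pn n).
  move/(integrableZl measurableT (2 ^- n)).
  by apply: eq_integrable => // t _ /=; rewrite tanh_weight_subX EFinM.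
have [|hi hE] := cintegral_hypergeometric (xi := xi) (c := tanh_beta p p xi)
    (z := p +i* (xi / 2)) (m := (p + p)%:C) N (N%:R + 2 * la) (la + 2^-1) wi.
  move=> n; have [ti tE] := tanh_integral xi p0 (pn n).
  rewrite -tanh_beta_addr// -tE.
  rewrite -(proj2 (cintegral_fourierZ (2 ^- n) xi ti)).
  by congr (cintegral _ _ _); apply/funext => t; rewrite tanh_weight_subX.
have [gi gE] := cintegral_fourierZ (pochhammer (2 * la) N / N`!%:R) xi hi; split.
  by apply: eq_integrable gi => // t _; rewrite /= /gegenbauer mulrCA.
rewrite -hE -gE; congr (cintegral _ _ _); apply/funext => t.
by rewrite /gegenbauer mulrCA.
Qed.

End transforms.

Section ball.
Context {R : realType} {d : nat}.
Implicit Types (e s x : 'I_d -> R) (k : 'I_d -> nat).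

(** Telescoping of the successive differences of the partial products. *)
Lemma prod_one_minus e m :
  \prod_(l < d | (l < m)%N) (1 - e l) =
  1 - \sum_(l < d | (l < m)%N) e l * \prod_(i < d | (i < l)%N) (1 - e i).
Proof.
elim: m => [|m ih]; first by rewrite !big_pred0// subr0.
have [md|dm] := ltnP m d.
  pose o := Ordinal md.
  have E (l : 'I_d) : ((l < m.+1)%N && (l != o)) = (l < m)%N.
    by rewrite ltnS ltn_neqAle andbC.
  rewrite (bigD1 o)//= [in RHS](bigD1 o)//=.
  under eq_bigl do rewrite E.
  under [X in _ - (_ + X)]eq_bigl do rewrite E.
  by rewrite ih/=; ring.
have E (l : 'I_d) : (l < m.+1)%N = (l < m)%N.
  by rewrite !(leq_trans (ltn_ord l))// leqW.
under eq_bigl do rewrite E.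
by under [in RHS]eq_bigl do rewrite E.
Qed.

Lemma powR_prod (I : Type) (r : seq I) (P : pred I) (f : I -> R) (y : R) :
  (forall i, 0 <= f i) ->
  (\prod_(i <- r | P i) f i) `^ y = \prod_(i <- r | P i) f i `^ y.
Proof.
move=> f0; elim: r => [|i r ih]; first by rewrite !big_nil powR1.
rewrite !big_cons; case: ifP => _; last exact: ih.
rewrite powRM ?ih // ?f0 //.
by apply: prodr_ge0 => l _; exact: f0.
Qed.

Lemma powR_sum (I : Type) (r : seq I) (P : pred I) (f : I -> R) (y : R) : 0 < y ->
  y `^ (\sum_(i <- r | P i) f i) = \prod_(i <- r | P i) y `^ f i.
Proof.
move=> y0; elim: r => [|i r ih]; first by rewrite !big_nil powRr0.
rewrite !big_cons; case: ifP => _; last exact: ih.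
by rewrite powRD ?ih// (gt_eqF y0) implybT.
Qed.

(** In these coordinates 1 - |y_(<j)|^2 is the product of the 1 - s_l^2 with
    l < j, so each argument y_j / sqrt (1 - |y_(<j)|^2) is s_j, and the factor
    1 - s_l^2 collects the exponents k_j / 2 of all j > l. *)
Lemma ball_poly_spherical mu k s : (forall j, 0 < 1 - s j ^+ 2) ->
  ball_poly mu k
    (fun j => s j * \prod_(l < d | (l < j)%N) Num.sqrt (1 - s l ^+ 2)) =
  \prod_(j < d) ((1 - s j ^+ 2) `^ ((tail_degree k j)%:R / 2) *
                 gegenbauer (lambda mu k j) (k j) (s j)).
Proof.
move=> s1; set y := fun j => _.
pose P m := \prod_(l < d | (l < m)%N) (1 - s l ^+ 2).
have P0 m : 0 < P m by apply: prodr_gt0.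
have sqP m : \prod_(l < d | (l < m)%N) Num.sqrt (1 - s l ^+ 2) = Num.sqrt (P m).
  have sq0 : 0 <= \prod_(l < d | (l < m)%N) Num.sqrt (1 - s l ^+ 2).
    by apply: prodr_ge0 => l _; exact: sqrtr_ge0.
  rewrite -(ger0_norm sq0) -sqrtr_sqr; congr Num.sqrt.
  rewrite -prodrXl; apply: eq_bigr => l _; rewrite sqr_sqrtr// ltW//.
have before j : 1 - sqnorm_before y j = P j.
  rewrite /P prod_one_minus; congr (1 - _); apply: eq_bigr => l _.
  by rewrite /y exprMn sqP sqr_sqrtr ?ltW.
rewrite /ball_poly; under eq_bigr => j _.
  rewrite before /y sqP mulfK ?gt_eqF ?sqrtr_gt0//; over.
rewrite !big_split /=; congr (_ * _).
have PX j r : P j `^ r = \prod_(l < d | (l < j)%N) (1 - s l ^+ 2) `^ r.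
  by apply: powR_prod => l; exact/ltW/s1.
under eq_bigr do rewrite PX.
rewrite (exchange_big_dep xpredT)//=; apply: eq_bigr => l _.
rewrite -powR_sum// -mulr_suml /tail_degree natr_sum.
by [].
Qed.

Lemma sum_tail_degree k : (\sum_(j < d) tail_degree k j = \sum_(j < d) j * k j)%N.
Proof.
rewrite /tail_degree (exchange_big_dep xpredT)//=; apply: eq_bigr => l _.
rewrite -[RHS]/(l * k l)%N -[in RHS](card_ord l) -sum_nat_const.
have ld : (l <= d)%N by exact: ltnW.
by rewrite (big_ord_widen d (fun=> k l) ld).
Qed.

Lemma sum_codim : \sum_(j < d) (codim j)%:R = d%:R * (d%:R - 1) / 2 :> R.
Proof.
have gauss m : \sum_(j < m) j%:R = m%:R * (m%:R - 1) / 2 :> R.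
  elim: m => [|m ih]; first by rewrite big_ord0 !mul0r.
  by rewrite big_ord_recr /= ih -natr1; field.
rewrite -gauss (reindex_inj rev_ord_inj) /codim /=.
by apply: eq_bigr => j _; rewrite subnSK// subKn// ltnW.
Qed.

End ball.

(** * Separation of variables on the cone *)

Section cone_factors.
Context {R : realType} {d : nat}.
Variables (n : nat) (k : 'I_d -> nat) (a b c beta mu gamma : R).

(** The exponent a + (d-j)/4 of the given weight and the exponent |k^(j+1)| / 2
    from the ball polynomial add up to [hahn_A]. *)
Definition ball_factor (j : 'I_d) (x : R) : R :=
  tanh_weight (hahn_A a k j) (hahn_A a k j) x *
  gegenbauer (lambda mu k j) (k j) (tanh x).

(** The factor tau_1^|k| contributes 2^(-|k|) (1 + tanh t)^|k|. *)
Definition radial_factor (t : R) : R :=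
  2 ^- degree k * (tanh_weight (b + (degree k)%:R) c t *
    jacobi (2 * (degree k)%:R + 2 * mu + beta + d%:R - 1) gamma
      (n - degree k)%N (- tanh t)).

Definition cone_factor (i : 'I_d.+1) : R -> R :=
  if unlift ord_max i is Some j then ball_factor j else radial_factor.

Lemma widen_ord_lift (j : 'I_d) : widen_ord (leqnSn d) j = lift ord_max j.
Proof. by apply: ord_inj; rewrite lift_max. Qed.

Lemma cone_factor_widen (j : 'I_d) :
  cone_factor (widen_ord (leqnSn d) j) = ball_factor j.
Proof. by rewrite /cone_factor widen_ord_lift liftK. Qed.

Lemma cone_factor_max : cone_factor ord_max = radial_factor.
Proof. by rewrite /cone_factor unlift_none. Qed.

Lemma one_sub_sqr_tanh (x : R) : 1 - tanh x ^+ 2 = (1 + tanh x) * (1 - tanh x).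
Proof. by ring. Qed.

Lemma one_sub_sqr_tanh_gt0 (x : R) : 0 < 1 - tanh x ^+ 2.
Proof. by rewrite one_sub_sqr_tanh mulr_gt0 ?addr_tanh_gt0 ?subr_tanh_gt0. Qed.

(** Separation of variables; the last coordinate of the tuple is t. *)
Lemma cone_fun_prod (z : Rn d.+1) :
  cone_fun n k a b c beta mu gamma z =
  \prod_(i < d.+1) cone_factor i (tnth z i).
Proof.
rewrite big_ord_recr /= cone_factor_max /cone_fun /cone_jacobi.
set t := tnth z ord_max; set x := fun j => tnth z (widen_ord _ j).
have tau0 : tau_cone t != 0 by rewrite /tau_cone gt_eqF// divr_gt0// addr_tanh_gt0.
have -> : (fun j => tau_ball t x j / tau_cone t) = (fun j => tanh (x j) *
    \prod_(l < d | (l < j)%N) Num.sqrt (1 - tanh (x l) ^+ 2)).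
  apply/funext => j; rewrite /tau_ball -/(tau_cone t).
  by rewrite mulrAC; congr (_ * _); rewrite mulrAC mulfV// mul1r.
rewrite (@ball_poly_spherical R d mu k (fun j => tanh (x j))); last first.
  by move=> j; exact: one_sub_sqr_tanh_gt0.
under [in RHS]eq_bigr => j _ do rewrite cone_factor_widen -/(x j).
have bE j : ball_factor j (x j) = (1 - tanh (x j) ^+ 2) `^ (a + (codim j)%:R / 4) *
    ((1 - tanh (x j) ^+ 2) `^ ((tail_degree k j)%:R / 2) *
     gegenbauer (lambda mu k j) (k j) (tanh (x j))).
  rewrite mulrA -powRD ?(gt_eqF (one_sub_sqr_tanh_gt0 _)) ?implybT//.
  rewrite one_sub_sqr_tanh powRM ?ltW ?addr_tanh_gt0 ?subr_tanh_gt0//.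
  by rewrite /ball_factor /tanh_weight /hahn_A addrAC.
under [in RHS]eq_bigr do rewrite bE.
rewrite [in RHS]big_split /=.
have -> : radial_factor t = (1 + tanh t) `^ b * (1 - tanh t) `^ c *
    tau_cone t ^+ degree k *
    jacobi (2 * (degree k)%:R + 2 * mu + beta + d%:R - 1) gamma
      (n - degree k)%N (- tanh t).
  by rewrite /radial_factor mulrA -tanh_weight_addX.
have -> : 1 - 2 * tau_cone t = - tanh t by rewrite /tau_cone; field.
by ring.
Qed.

End cone_factors.

(** * The spherical factors *)

Section complex_parameters.
Context {R : realType} {d : nat}.
Implicit Types (k : 'I_d -> nat) (j : 'I_d).

(** The equal exponents p = q = A make p + q real and both Gamma arguments
    A +- i xi/2. *)
Lemma theta_beta_tanh (a xi : R) k j : let A := hahn_A a k j in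
  tanh_beta A A xi = (2 `^ (A + A - 1))%:C * theta_beta a k xi j.
Proof.
move=> A; rewrite /tanh_beta /theta_beta /cbeta; congr (_ * _).
have -> : a%:C + ((tail_degree k j)%:R + 'i * xi%:C) / 2 + (codim j)%:R / 4 =
    A +i* (xi / 2).
  rewrite [RHS]complexE complexiE /A /hahn_A /=.
  by rewrite !(rmorph_nat, rmorph1, rmorphD, rmorphN, rmorphM, fmorphV) /=; field.
have -> : a%:C + ((tail_degree k j)%:R - 'i * xi%:C) / 2 + (codim j)%:R / 4 =
    A +i* (- (xi / 2)).
  rewrite [RHS]complexE complexiE /A /hahn_A /=.
  by rewrite !(rmorph_nat, rmorph1, rmorphD, rmorphN, rmorphM, fmorphV) /=; field.
have -> : (A +i* (xi / 2)) + (A +i* (- (xi / 2))) = (A + A)%:C.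
  by apply/eqP; rewrite eq_complex /= subrr !eqxx.
by rewrite [cgamma (A +i* (- (xi / 2))) * _]mulrC.
Qed.

Lemma gegenbauer_transform_Theta (a mu xi : R) k j : 0 < a ->
  (@lebesgue_measure R).-integrable setT (EFin \o ball_factor k a mu j) /\
  cintegral (@lebesgue_measure R) setT
    (fun x => (ball_factor k a mu j x)%:C * expi (- (xi * x))) =
  (2 `^ (hahn_A a k j + hahn_A a k j - 1))%:C *
  ((pochhammer (2 * ((tail_degree k j)%:R + mu + (codim j)%:R / 2))
             (k j) / (k j)`!%:R)%:C * Theta a mu k xi j).
Proof.
move=> a0; have A0 : 0 < hahn_A a k j.
  by rewrite /hahn_A -addrA ltr_wpDr// addr_ge0// divr_ge0.
have [bi bE] := gegenbauer_transform (lambda mu k j) (k j) xi A0.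
split=> //; rewrite bE theta_beta_tanh /Theta.
have -> : lambda mu k j = (tail_degree k j)%:R + mu + (codim j)%:R / 2.
  by rewrite /lambda [mu + _]addrC.
have -> : ((k j)%:R + 2 * ((tail_degree k j)%:R + mu + (codim j)%:R / 2))%:C =
    (k j)%:R + 2 * ((tail_degree k j)%:R + mu%:C + (codim j)%:R / 2).
  by rewrite !(rmorph_nat, rmorph1, rmorphD, rmorphN, rmorphM, fmorphV).
have -> : hahn_A a k j +i* (xi / 2) =
    a%:C + ((tail_degree k j)%:R + 'i * xi%:C) / 2 + (codim j)%:R / 4.
  rewrite [LHS]complexE complexiE /hahn_A /=.
  by rewrite !(rmorph_nat, rmorph1, rmorphD, rmorphN, rmorphM, fmorphV) /=; field.
have -> : ((tail_degree k j)%:R + mu + (codim j)%:R / 2 + 2^-1)%:C =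
    (tail_degree k j)%:R + mu%:C + ((codim j)%:R + 1) / 2.
  by rewrite !(rmorph_nat, rmorph1, rmorphD, rmorphN, rmorphM, fmorphV) /=; field.
have -> : (hahn_A a k j + hahn_A a k j)%:C =
    (tail_degree k j)%:R + 2 * a%:C + (codim j)%:R / 2.
  by rewrite /hahn_A !(rmorph_nat, rmorph1, rmorphD, rmorphN, rmorphM, fmorphV) /=; field.
by rewrite -(mulrA _ (theta_beta _ _ _ _)) mulrCA.
Qed.

Lemma Theta_hahn (a mu xi : R) k j : 0 < a -> - (1 / 2) < mu ->
  Theta a mu k xi j =
    (k j)`!%:R /
    ('i ^+ k j *
     pochhammer ((tail_degree k j)%:R + mu%:C + ((codim j)%:R + 1) / 2) (k j) *
     pochhammer ((tail_degree k j)%:R + 2 * a%:C + (codim j)%:R / 2) (k j)) *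
    theta_beta a k xi j *
    continuous_hahn (k j) (xi / 2)%:C
      (hahn_A a k j)%:C (hahn_M a mu k j)%:C
      (hahn_M a mu k j)%:C (hahn_A a k j)%:C.
Proof.
move=> a0 mu0; rewrite /Theta /continuous_hahn.
set P := (tail_degree k j)%:R + mu%:C + ((codim j)%:R + 1) / 2.
set Q := (tail_degree k j)%:R + 2 * a%:C + _.
have PE : (hahn_A a k j)%:C + (hahn_M a mu k j)%:C = P.
  rewrite /P /hahn_A /hahn_M.
  by rewrite !(rmorph_nat, rmorph1, rmorphD, rmorphN, rmorphM, fmorphV) /=; field.
have QE : (hahn_A a k j)%:C + (hahn_A a k j)%:C = Q.
  rewrite /Q /hahn_A.
  by rewrite !(rmorph_nat, rmorph1, rmorphD, rmorphN, rmorphM, fmorphV) /=; field.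
have P0 : 0 < P.
  rewrite -PE -rmorphD /= ltcR /hahn_A /hahn_M.
  have : 0 <= (tail_degree k j)%:R :> R by [].
  have : 0 <= (codim j)%:R :> R by [].
  lra.
have Q0 : 0 < Q.
  rewrite -QE -rmorphD /= ltcR /hahn_A.
  have : 0 <= (tail_degree k j)%:R :> R by [].
  have : 0 <= (codim j)%:R :> R by [].
  lra.
rewrite PE QE.
have -> : (k j)%:R + (hahn_A a k j)%:C + (hahn_M a mu k j)%:C +
    (hahn_M a mu k j)%:C + (hahn_A a k j)%:C - 1 =
    (k j)%:R + 2 * ((tail_degree k j)%:R + mu%:C + (codim j)%:R / 2).
  by rewrite /hahn_A /hahn_M !(rmorph_nat, rmorph1, rmorphD, rmorphN, rmorphM, fmorphV) /=; field.
have -> : (hahn_A a k j)%:C + 'i * (xi / 2)%:C =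
    a%:C + ((tail_degree k j)%:R + 'i * xi%:C) / 2 + (codim j)%:R / 4.
  by rewrite /hahn_A !(rmorph_nat, rmorph1, rmorphD, rmorphN, rmorphM, fmorphV) /=; field.
set H := hypergeometric _ _ _.
have i0 : 'i ^+ k j != 0 :> R[i].
  by rewrite expf_neq0// neq0Ci.
have f0 : (k j)`!%:R != 0 :> R[i] by rewrite pnatr_eq0 -lt0n fact_gt0.
have p0 := pochhammer_neq0 (k j) P0.
have q0 := pochhammer_neq0 (k j) Q0.
field.
by rewrite p0 q0 f0 i0.
Qed.

End complex_parameters.

(** * The radial factor and the theorem *)

Section radial.
Context {R : realType} {d : nat}.
Implicit Types (k : 'I_d -> nat).

(** Here p = b + |k| and q = c: the 2^|k| in the value of the beta integral
    cancels the 2^(-|k|) of [radial_factor]. *)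
Lemma jacobi_transform_Xi n k (b c beta mu gamma xi : R) :
  (degree k <= n)%N -> 0 < b + (degree k)%:R -> 0 < c ->
  (@lebesgue_measure R).-integrable setT
    (EFin \o radial_factor n k b c beta mu gamma) /\
  cintegral (@lebesgue_measure R) setT
    (fun t => (radial_factor n k b c beta mu gamma t)%:C * expi (- (xi * t))) =
  (2 `^ (b + c - 1))%:C *
  ((pochhammer (2 * (degree k)%:R + 2 * mu + beta + d%:R)
      (n - degree k)%N)%:C *
   cgamma ((b + (degree k)%:R)%:C - 'i * xi%:C / 2) *
   cgamma (c%:C + 'i * xi%:C / 2) /
   ((n - degree k)`!%:R * cgamma ((degree k)%:R + b + c)%:C)) *
  Xi n k b c mu beta gamma xi.
Proof.
move=> kn b0 c0.
have [ji jE] := jacobi_transform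
  (2 * (degree k)%:R + 2 * mu + beta + d%:R - 1) gamma (n - degree k) xi b0 c0.
have [ri rE] := cintegral_fourierZ (2 ^- degree k) xi ji.
split=> //; rewrite rE jE subrK /tanh_beta /Xi.
have -> : (b + (degree k)%:R)%:C - 'i * xi%:C / 2 =
    (b + (degree k)%:R) +i* (- (xi / 2)).
  rewrite [RHS]complexE complexiE /=.
  by rewrite !(rmorph_nat, rmorph1, rmorphD, rmorphN, rmorphM, fmorphV) /=; field.
have -> : c%:C + 'i * xi%:C / 2 = c +i* (xi / 2).
  rewrite [RHS]complexE complexiE /=.
  by rewrite !(rmorph_nat, rmorph1, rmorphD, rmorphN, rmorphM, fmorphV) /=; field.
have -> : ((degree k)%:R + b)%:C - 'i * xi%:C / 2 =
    (b + (degree k)%:R) +i* (- (xi / 2)).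
  rewrite [RHS]complexE complexiE /=.
  by rewrite !(rmorph_nat, rmorph1, rmorphD, rmorphN, rmorphM, fmorphV) /=; field.
rewrite !natrB// opprB [- n%:R + _]addrC.
have -> : (n%:R - (degree k)%:R + (2 * (degree k)%:R + 2 * mu + beta + d%:R - 1)
    + gamma + 1)%:C =
  (n%:R + (degree k)%:R + 2 * mu + beta + gamma + d%:R)%:C :> R[i].
  by congr (_%:C); ring.
have -> : b + (degree k)%:R + c = (degree k)%:R + b + c by rewrite [b + _]addrC.
have -> : 2 `^ ((degree k)%:R + b + c - 1) =
    2 ^+ degree k * 2 `^ (b + c - 1) :> R.
  rewrite -!addrA powRD ?pnatr_eq0 ?implybT// powR_mulrn//.
rewrite rmorphM !rmorphM /= !fmorphV !rmorph_nat.
set H := hypergeometric _ _ _; set P := pochhammer _ _.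
have g0 : cgamma ((degree k)%:R + b + c)%:C != 0.
  by apply: cgammaR_neq0; rewrite [_ + b]addrC addr_gt0.
have f0 : (n - degree k)`!%:R != 0 :> R[i] by rewrite pnatr_eq0 -lt0n fact_gt0.
have t0 : (2 ^+ degree k)%:C != 0 :> R[i].
  by apply/eqP => /complexI/eqP; rewrite expf_eq0 pnatr_eq0 andbF.
field.
by rewrite g0 f0 t0.
Qed.

(** The powers of 2 produced by the d spherical factors. *)
Lemma sum_hahn_A (a : R) k :
  \sum_(j < d) (hahn_A a k j + hahn_A a k j - 1) =
  2 * a * d%:R + d%:R * (d%:R - 5) / 4 + (\sum_(j < d) j * k j)%N%:R.
Proof.
transitivity (\sum_(j < d) ((2 * a - 1) + ((tail_degree k j)%:R + (codim j)%:R / 2))).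
  by apply: eq_bigr => j _; rewrite /hahn_A; field.
rewrite big_split [X in _ + X = _]big_split /= -[X in _ + (_ + X) = _]mulr_suml sum_codim -natr_sum sum_tail_degree.
by rewrite sumr_const card_ord -mulr_natr; field.
Qed.

End radial.

Theorem theorem3p4 (R : realType) (d n : nat) (k : 'I_d -> nat)
    (a b c beta mu gamma : R)
    (d_ge1 : (1 <= d)%N) (k_le_n : (degree k <= n)%N)
    (a_gt0 : 0 < a) (bk_gt0 : 0 < b + (degree k)%:R) (c_gt0 : 0 < c)
    (mu_gt : - (1 / 2) < mu)
    (alpha_gt0 : 0 < 2 * (degree k)%:R + 2 * mu + beta + d%:R) :
  let g := cone_fun n k a b c beta mu gamma in
  (lebesgue_Rn d.+1).-integrable setT (EFin \o g) /\
  forall xi : 'I_d.+1 -> R,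
    let xi_x (j : 'I_d) : R := xi (widen_ord (leqnSn d) j) in
    let xi_t : R := xi ord_max in
    fourier (fun z => (g z)%:C) xi =
      (2 `^ (b + c - 1 + 2 * a * d%:R + d%:R * (d%:R - 5) / 4
             + (\sum_(j < d) j * k j)%N%:R))%:C *
      ((pochhammer (2 * (degree k)%:R + 2 * mu + beta + d%:R)
          (n - degree k)%N)%:C *
       cgamma ((b + (degree k)%:R)%:C - 'i * xi_t%:C / 2) *
       cgamma (c%:C + 'i * xi_t%:C / 2) /
       ((n - degree k)`!%:R * cgamma ((degree k)%:R + b + c)%:C)) *
      (\prod_(j < d)
         ((pochhammer (2 * ((tail_degree k j)%:R + mu + (codim j)%:R / 2))
             (k j) / (k j)`!%:R)%:C *
          Theta a mu k (xi_x j) j)) *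
      Xi n k b c mu beta gamma xi_t /\
    forall j : 'I_d,
      Theta a mu k (xi_x j) j =
        (k j)`!%:R /
        ('i ^+ k j *
         pochhammer ((tail_degree k j)%:R + mu%:C + ((codim j)%:R + 1) / 2)
           (k j) *
         pochhammer ((tail_degree k j)%:R + 2 * a%:C + (codim j)%:R / 2)
           (k j)) *
        theta_beta a k (xi_x j) j *
        continuous_hahn (k j) (xi_x j / 2)%:C
          (hahn_A a k j)%:C (hahn_M a mu k j)%:C
          (hahn_M a mu k j)%:C (hahn_A a k j)%:C.
Proof.
move=> g.
pose h := cone_factor n k a b c beta mu gamma.
have hi i : (@lebesgue_measure R).-integrable setT (EFin \o h i).
  rewrite /h /cone_factor; case: unlift => [j|].
    by have [] := gegenbauer_transform_Theta mu 0 k j a_gt0.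
  by have [] := jacobi_transform_Xi beta mu gamma 0 k_le_n bk_gt0 c_gt0.
split.
  have [[+ _] _] := cintegral_tuple (m := @lebesgue_measure R) (n := d.+1)
    (f := fun i t => (h i t)%:C) (fun i => cintegrableC (hi i)).
  apply: eq_integrable => // z _ /=.
  by rewrite /g cone_fun_prod -(rmorph_prod (real_complex R)).
move=> xi xi_x xi_t; split; last by move=> j; exact: Theta_hahn.
rewrite /fourier.
have -> : (fun z : Rn d.+1 =>
    cexp (- ('i * (\sum_(j < d.+1) xi j * tnth z j)%:C)) * (g z)%:C) =
    (fun z => \prod_(i < d.+1) ((h i (tnth z i))%:C * expi (- (xi i * tnth z i)))).
  apply/funext => z; rewrite cexp_imag -sumrN expi_sum /g cone_fun_prod.
  by rewrite (rmorph_prod (real_complex R)) big_split mulrC.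
rewrite (proj2 (cintegral_tuple (m := @lebesgue_measure R)
  (f := fun i t => (h i t)%:C * expi (- (xi i * t)))
  (fun i => cintegrable_fourier (xi i) (hi i)))).
rewrite big_ord_recr /= /h cone_factor_max.
rewrite (proj2 (jacobi_transform_Xi _ _ _ _ k_le_n bk_gt0 c_gt0)).
under eq_bigr => j _.
  rewrite cone_factor_widen (proj2 (gegenbauer_transform_Theta _ _ _ _ a_gt0)).
  over.
rewrite big_split /= -rmorph_prod -powR_sum// sum_hahn_A.
rewrite -/xi_t.
have -> : b + c - 1 + 2 * a * d%:R + d%:R * (d%:R - 5) / 4 +
    (\sum_(j < d) j * k j)%N%:R = (b + c - 1) +
    (2 * a * d%:R + d%:R * (d%:R - 5) / 4 + (\sum_(j < d) j * k j)%N%:R).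
  by ring.
rewrite [in RHS]powRD ?pnatr_eq0 ?implybT// [in RHS]rmorphM /=.
set X := (2 `^ (b + c - 1))%:C; set Y := (2 `^ _)%:C.
set Z := Xi _ _ _ _ _ _ _ _; set W := \prod_(j < d) _.
set V := _ / (_ * cgamma _).
ring.
Qed.
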